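(* Let $(G,R)$ be an abelian cyclically ordered group which is not c-archimedean, and let $n\ge2$ be an integer. The following assertions are equivalent. (1) $G$ is $n$-regular and $K(G)\neq\{0\}$. (2) $l(G)$ is $n$-regular, $K(G)\ne\{0\}$, and for every $\theta\in[0,\pi]$ such that $e^{i\theta}\in K(G)$ we have $e^{i\theta/n}\in K(G)$. (3) $G$ is c-$n$-regular. (4) $l(G)$ is $n$-regular, $K(G)$ is $n$-divisible and $K(G)$ contains a primitive $n$-th root of $1$.
   Context: All groups are abelian, written additively except subgroups of $\mathbb{K}$. A cyclically ordered group $(G,R)$ is an abelian group $G$ with a ternary relation $R$ such that: $R(a,b,c)$ implies that $a,b,c$ are pairwise distinct; $R(a,b,c)\Rightarrow R(b,c,a)$; for every $c\in G$, $R(c,\cdot,\cdot)$ is a strict linear order on $G\setminus\{c\}$; $R(a,b,c)\Rightarrow R(a+u,b+u,c+u)$. $\mathbb{K}$ is the group of complex numbers of modulus $1$, cyclically ordered by: for $0\le\theta_1,\theta_2,\theta_3<2\pi$, $R(e^{i\theta_1},e^{i\theta_2},e^{i\theta_3})$ iff $\theta_1<\theta_2<\theta_3$ up to cyclic permutation of the indices. The unwound of $(G,R)$ is the linearly ordered group $\mathrm{uw}(G)$ with underlying set $\mathbb{Z}\times G$, where $(n,c)<(n',c')$ iff $n<n'$, or $n=n'$ and $R(0,c,c')$, or $n=n'$ and $c=0\ne c'$; the addition is $(m,a)+(n,b)=(m+n,a+b)$ if $a=0$ or $b=0$ or $R(0,a,a+b)$, and $(m+n+1,a+b)$ if $R(0,a+b,a)$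 or $a+b=0\neq a$. Put $z_G=(1,0)$; it is positive and cofinal, and $G\simeq\mathrm{uw}(G)/\langle z_G\rangle$. Let $C$ be the greatest proper convex subgroup of $\mathrm{uw}(G)$ (so $-z_G<C<z_G$). The linear part $l(G)$ is the image of $C$ in $G$ (an isomorphic copy of $C$), with the linear order inherited from $\mathrm{uw}(G)$. $K(G)=G/l(G)$ is cyclically ordered by: for $a,b,c$ in pairwise distinct classes, $R(\bar a,\bar b,\bar c)$ iff $R(a,b,c)$. $K(G)$ embeds, as a cyclically ordered group, in $\mathbb{K}$, and is identified with its image. $G$ is c-archimedean if $l(G)=\{0\}$ (equivalently $G$ is isomorphic to a subgroup of $\mathbb{K}$). $R(x_1,\dots,x_m)$ (with $m\ge3$) means that $R(x_i,x_j,x_k)$ holds for all $1\le i<j<k\le m$. $(G,R)$ is $n$-regular if for all $x_1,\dots,x_n\in G$ with $R(0,x_1,\dots,x_n,-x_n)$ there is $x\in G$ such that ($R(x_1,nx,x_n)$ or $nx=x_1$ or $nx=x_n$) and $R(0,x,\dots,(n-1)x,x_n)$. $(G,R)$ is c-$n$-regular if the same conclusion holds for all $x_1,\dots,x_n\in G$ with $R(0,x_1,\dots,x_n)$. A linearly ordered abelian group is $n$-regular if for all $0<x_1<\cdots<x_n$ there is $x$ with $x_1\le nx\le x_n$; the assertion ''$l(G)$ is $n$-regular'' is meant in this sense. *)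

(* Defs.v *)
From HB Require Import structures.
From mathcomp Require Import all_boot all_order all_algebra.
From mathcomp Require Import zify ring lra.
From mathcomp Require Import generic_quotient ring_quotient.
From mathcomp Require Import all_classical all_reals all_analysis.
From mathcomp Require Import complex.

Set Implicit Arguments.
Unset Strict Implicit.
Unset Printing Implicit Defensive.

Import Order.TTheory GRing.Theory Num.Theory.
Local Open Scope classical_set_scope.
Local Open Scope quotient_scope.
Local Open Scope ring_scope.

(* The strict linear order R(c, _, _) on G \ {c} is given by cyc_trans and
   cyc_total; its irreflexivity is part of cyc_neq. *)
HB.mixin Record Zmodule_isCyclicallyOrdered G of GRing.Zmodule G := {
  cyc : G -> G -> G -> bool;
  cyc_neq : forall a b c, cyc a b c -> [/\ a != b, b != c & a != c];
  cyc_rot : forall a b c, cyc a b c -> cyc b c a;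
  cyc_trans : forall c a b d, cyc c a b -> cyc c b d -> cyc c a d;
  cyc_total : forall c a b, a != c -> b != c -> a != b -> cyc c a b || cyc c b a;
  cycDr : forall u a b c, cyc a b c -> cyc (a + u) (b + u) (c + u)
}.

#[short(type="cycZmodType")]
HB.structure Definition CyclicallyOrderedZmodule :=
  { G of Zmodule_isCyclicallyOrdered G & GRing.Zmodule G }.

Arguments cyc_neq {s} [a b c].
Arguments cyc_rot {s} [a b c].
Arguments cyc_trans {s} [c a b d].
Arguments cyc_total {s} [c a b].
Arguments cycDr {s} u [a b c].

Section CutOrder.
Variable G : cycZmodType.
Implicit Types a b c d u p : G.

(* G cut at 0: the linear order with least element 0 that induces cyc *)
Definition clt a b : bool := cyc 0 a b || ((a == 0) && (b != 0)).

Lemma clt_irr a : clt a a = false.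
Proof. by apply/negP => /orP[/cyc_neq[_]|/andP[->//]]; rewrite eqxx. Qed.

Lemma clt_trans b a c : clt a b -> clt b c -> clt a c.
Proof.
rewrite /clt => /orP[ab|/andP[a0 b0]] /orP[bc|/andP[b1 c0]].
- by rewrite (cyc_trans ab bc).
- by case: (cyc_neq ab); rewrite (eqP b1) eqxx.
- by case: (cyc_neq bc) => _ _; rewrite a0 eq_sym => ->; rewrite orbT.
- by rewrite b1 in b0.
Qed.

Lemma clt_total a b : a != b -> clt a b || clt b a.
Proof.
rewrite /clt; case: (eqVneq a 0) => [->|a0]; case: (eqVneq b 0) => [->|b0] //=.
- by rewrite ?eqxx ?orbT.
- by rewrite ?eqxx ?orbT.
- by move=> ab; rewrite !orbF cyc_total.
Qed.

Lemma clt_asym a b : clt a b -> clt b a = false.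
Proof. by move=> ab; apply/negP => /(clt_trans ab); rewrite clt_irr. Qed.

Lemma clt_neg a b : a != b -> clt b a = ~~ clt a b.
Proof.
by move=> /clt_total/orP[]h; rewrite h (clt_asym h).
Qed.

Lemma clt0r a : clt a 0 = false.
Proof.
by apply/negP => /orP[/cyc_neq[_]|/andP[_]]; rewrite eqxx.
Qed.

Lemma clt0l a : clt 0 a = (a != 0).
Proof.
rewrite /clt eqxx /=; case: (boolP (cyc _ _ _)) => //= /cyc_neq[].
by rewrite eqxx.
Qed.

Lemma cltE a b : a != 0 -> clt a b = cyc 0 a b.
Proof. by rewrite /clt => /negPf->; rewrite orbF. Qed.

Lemma cyc_rotE a b c : cyc a b c = cyc b c a.
Proof. by apply/idP/idP => [/cyc_rot//|/cyc_rot/cyc_rot]. Qed.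

Lemma cyc_asym a b c : cyc a b c -> cyc a c b = false.
Proof.
by move=> h; apply/negP => /(cyc_trans h) /cyc_neq[_]; rewrite eqxx.
Qed.

Lemma cycDrE u a b c : cyc (a + u) (b + u) (c + u) = cyc a b c.
Proof.
apply/idP/idP => [/(cycDr (- u))|/cycDr//]; by rewrite !addrK.
Qed.

Lemma cyc_clt_dir a b c : clt a b -> clt b c -> cyc a b c.
Proof.
have [->|b0] := eqVneq b 0; first by rewrite clt0r.
have [->|a0] := eqVneq a 0; first by rewrite (cltE _ b0).
rewrite (cltE _ a0) (cltE _ b0) => ab bc.
have h1 : cyc b c 0 by rewrite -cyc_rotE.
have h2 : cyc b 0 a by rewrite cyc_rotE.
by rewrite cyc_rotE; apply: cyc_trans h1 h2.
Qed.

Lemma cyc_clt a b c : cyc a b c =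
  [|| clt a b && clt b c, clt b c && clt c a | clt c a && clt a b].
Proof.
apply/idP/idP; last first.
  case/or3P => /andP[/cyc_clt_dir h /h]//.
  - by rewrite -cyc_rotE.
  - by rewrite cyc_rotE.
move=> h; have h' := cyc_asym h; have [nab nbc nac] := cyc_neq h.
have acb := @cyc_clt_dir a c b; have cba := @cyc_clt_dir c b a.
have bac := @cyc_clt_dir b a c; move: acb cba bac.
rewrite -(cyc_rotE a c b) (cyc_rotE b a c) h'.
rewrite (clt_neg nab) (clt_neg nbc) (clt_neg nac).
by case: (clt a b); case: (clt b c); case: (clt a c) => //= h1 h2 h3;
  do [case: (h1 isT isT) => // | case: (h2 isT isT) => // | case: (h3 isT isT)].
Qed.

Definition carry a b : bool := clt (a + b) a.

Lemma carryN a b : a != 0 -> b != 0 -> carry a b = ~~ clt b (- a).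
Proof.
move=> a0 b0; rewrite /carry.
rewrite clt_neg ?cltE//; last by rewrite -subr_eq0 opprD addNKr oppr_eq0.
by rewrite -(cycDrE (- a)) subrr sub0r addrAC subrr add0r cyc_rotE.
Qed.

Lemma carry0 a : carry a 0 = false. Proof. by rewrite /carry addr0 clt_irr. Qed.
Lemma carry0l a : carry 0 a = false. Proof. by rewrite /carry clt0r. Qed.

Lemma carryE a b : carry a b = ~~ [|| a == 0, b == 0 | cyc 0 a (a + b)].
Proof.
have [->|a0] := eqVneq a 0; first by rewrite carry0l.
have [->|b0] := eqVneq b 0; first by rewrite carry0.
by rewrite /= -cltE// /carry clt_neg// -subr_eq0 opprD addNKr oppr_eq0.
Qed.

Lemma cyc0N a b : cyc 0 a b -> cyc 0 (- b) (- a).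
Proof.
move=> h; have [na nab nb] := cyc_neq h.
have ab1 := cyc_rot h; have ab2 := cyc_rot ab1.
have na' : - a != 0 by rewrite oppr_eq0 eq_sym.
have nb' : - b != 0 by rewrite oppr_eq0 eq_sym.
have nba : b - a != 0 by rewrite subr_eq0 eq_sym.
have nab' : a - b != 0 by rewrite subr_eq0.
have h1 : clt (- b) (a - b).
  by rewrite cltE// -(cycDrE b) add0r addNr subrK.
have h2 : clt (b - a) (- a).
  by rewrite cltE// -(cycDrE a) add0r addNr subrK.
case: (boolP (cyc 0 (- b) (- a))) => // h3.
have h4 : clt (- a) (- b).
  by rewrite clt_neg ?eqr_opp 1?eq_sym// cltE.
have h5 : clt (b - a) (- b) by apply: clt_trans h4.
have h7 : clt b (b - a).
  rewrite cltE 1?eq_sym//; move: h4; rewrite cltE//.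
  by rewrite -(cycDrE b) add0r addNr [- a + b]addrC -cyc_rotE.
have h8 : clt (a - b) a.
  rewrite cltE//; move: h4; rewrite cltE//.
  by rewrite -(cycDrE a) add0r addNr [- b + a]addrC cyc_rotE.
have h9 : clt a b by rewrite cltE 1?eq_sym.
have := clt_trans h9 (clt_trans h7 (clt_trans h5 (clt_trans h1 h8))).
by rewrite clt_irr.
Qed.

Lemma carryC a b : carry a b = carry b a.
Proof.
have [->|a0] := eqVneq a 0; first by rewrite carry0l carry0.
have [->|b0] := eqVneq b 0; first by rewrite carry0l carry0.
rewrite !carryN// !cltE//; congr (~~ _).
by apply/idP/idP => /cyc0N; rewrite opprK.
Qed.

Lemma carry_cocycle a b d :
  (carry a b + carry (a + b)%R d = carry b d + carry a (b + d)%R)%N.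
Proof.
have -> : carry b d =
    cyc a (a + b + d) (a + b) || (a + b + d == a) && (a + b != a).
  have e x : (a + x == a) = (x == 0) by rewrite -subr_eq0 addrAC subrr add0r.
  rewrite {1}/carry /clt -(cycDrE a) add0r -[a + b + d]addrA !e.
  by rewrite ![_ + a]addrC.
rewrite /carry addrA.
move: (a + b) (a + b + d) => p2 p3; rewrite cyc_clt.
have [->|n12] := eqVneq a p2.
  have [->|n23] := eqVneq p2 p3; first by rewrite !clt_irr ?eqxx.
  by rewrite !clt_irr !andbF (clt_neg n23); case: (clt _ _).
have [->|n13] := eqVneq p3 a.
  by rewrite !clt_irr (clt_neg n12); case: (clt _ _).
have [->|n23] := eqVneq p2 p3.
  by rewrite !clt_irr (clt_neg n13); case: (clt _ _).
rewrite /= (clt_neg n12) (clt_neg n23) (clt_neg n13) orbF.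
have := @clt_trans p2 a p3; have := @clt_trans p2 p3 a.
rewrite (clt_neg n12) (clt_neg n23) (clt_neg n13).
by case: (clt a p2); case: (clt p2 p3); case: (clt p3 a) => //= h1 h2;
  do [case: (h1 isT isT) => //|case: (h2 isT isT) => //].
Qed.

Lemma carry_lt1 a b d : carry a d -> ~~ carry b d -> clt (a + d) (b + d).
Proof.
rewrite ![carry _ d]carryC /carry ![d + _]addrC => h1 h2.
have [e|n] := eqVneq (b + d) d; first by rewrite e.
by apply: clt_trans h1 _; rewrite clt_neg.
Qed.

Lemma carry_homo a b d : clt a b -> carry a d -> carry b d.
Proof.
have [->|a0] := eqVneq a 0; first by rewrite carry0l.
have [->|b0] := eqVneq b 0; first by rewrite clt0r.
have [->|d0] := eqVneq d 0; first by rewrite carry0.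
move=> ab; rewrite ![carry _ d]carryC !carryN//.
by apply: contra; apply: clt_trans.
Qed.

Lemma carry_lt2 a b d : clt a b -> carry a d = carry b d ->
  clt (a + d) (b + d).
Proof.
move=> /[dup] ab /orP[|/andP[/eqP-> b0]]; last first.
  rewrite carry0l carryC add0r /carry addrC => h; rewrite clt_neg -?h//.
  by rewrite -subr_eq0 addrK.
move/(cycDr d); rewrite add0r cyc_clt ![carry _ d]carryC /carry ![d + _]addrC.
move=> + e; case/or3P => /andP[]// h.
by move/clt_asym; rewrite e h.
Qed.

End CutOrder.


Definition uw (G : cycZmodType) : Type := (int * G)%type.

HB.instance Definition _ (G : cycZmodType) := Choice.copy (uw G) (int * G)%type.

Section Unwound.
Variable G : cycZmodType.
Implicit Types x y z : uw G.

Definition uw_add x y : uw G :=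
  if [|| x.2 == 0, y.2 == 0 | cyc 0 x.2 (x.2 + y.2)]
  then (x.1 + y.1, x.2 + y.2) else (x.1 + y.1 + 1, x.2 + y.2).

Definition uw_zero : uw G := (0, 0).

Definition uw_opp x : uw G := (- x.1 - (x.2 != 0)%:Z, - x.2).

Definition uw_lt x y : bool := (x.1 < y.1) || ((x.1 == y.1) && clt x.2 y.2).

Definition uw_le x y : bool := (x == y) || uw_lt x y.

Lemma uw_addE x y : uw_add x y = (x.1 + y.1 + (carry x.2 y.2)%:Z, x.2 + y.2).
Proof. by rewrite /uw_add carryE; case: ifP => //= _; rewrite addr0. Qed.

Lemma uw_addA : associative uw_add.
Proof.
move=> x y z; rewrite !uw_addE /=; congr pair; last by rewrite addrA.
have /(congr1 Posz) := carry_cocycle x.2 y.2 z.2; rewrite !PoszD => h.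
lia.
Qed.

Lemma uw_addC : commutative uw_add.
Proof.
by move=> x y; rewrite !uw_addE carryC [x.2 + _]addrC [x.1 + _]addrC.
Qed.

Lemma uw_add0 : left_id uw_zero uw_add.
Proof. by case=> n a; rewrite /uw_add eqxx /= !add0r. Qed.

Lemma uw_addN : left_inverse uw_zero uw_opp uw_add.
Proof.
case=> n a; rewrite uw_addE /= addNr carryC /carry subrr clt0l.
by congr pair; lia.
Qed.

HB.instance Definition _ :=
  GRing.isZmodule.Build (uw G) uw_addA uw_addC uw_add0 uw_addN.

Lemma uw_lt_irr : irreflexive uw_lt.
Proof. by move=> x; rewrite /uw_lt ltxx eqxx clt_irr. Qed.

Lemma uw_lt_trans : transitive uw_lt.
Proof.
move=> y x z /orP[xy|/andP[/eqP xy xy']] /orP[yz|/andP[/eqP yz yz']].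
- by rewrite /uw_lt (lt_trans xy yz).
- by rewrite /uw_lt -yz xy.
- by rewrite /uw_lt xy yz.
- by rewrite /uw_lt xy yz eqxx (clt_trans xy' yz') orbT.
Qed.

Lemma uw_lt_total x y : x != y -> uw_lt x y || uw_lt y x.
Proof.
move=> xy; rewrite /uw_lt; case: ltgtP => //= e.
by apply: clt_total; apply: contra xy => /eqP e2; apply/eqP;
  rewrite [x]surjective_pairing [y]surjective_pairing e e2.
Qed.

HB.instance Definition _ := Order.LtOrder.Build ring_display (uw G)
  (fun _ _ => erefl : uw_le _ _ = _) (fun _ _ => erefl) (fun _ _ => erefl)
  uw_lt_irr uw_lt_trans uw_lt_total.

Definition uw_z : uw G := (1, 0).

Lemma uw_ltE x y : (x < y) = (x.1 < y.1) || ((x.1 == y.1) && clt x.2 y.2).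
Proof. by []. Qed.

Lemma uwDE x y : x + y = (x.1 + y.1 + (carry x.2 y.2)%:Z, x.2 + y.2).
Proof. exact: uw_addE. Qed.

Lemma uwNE x : - x = (- x.1 - (x.2 != 0)%:Z, - x.2). Proof. by []. Qed.

Lemma uw_ltD z x y : x < y -> x + z < y + z.
Proof.
rewrite !uwDE !uw_ltE /= => /orP[xy|/andP[/eqP-> xy]]; last first.
  have := @carry_homo _ _ _ z.2 xy; have := @carry_lt2 _ _ _ z.2 xy.
  case: (carry x.2 _); case: (carry y.2 _) => //= h1 h2.
  - by rewrite h1 // eqxx orbT.
  - by have := h2 isT.
  - by apply/orP; left; lia.
  - by rewrite h1 // eqxx orbT.
have := @carry_lt1 _ x.2 y.2 z.2.
case: (carry x.2 _); case: (carry y.2 _) => //= h.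
- by apply/orP; left; lia.
- by rewrite h// andbT; lia.
- by apply/orP; left; lia.
- by apply/orP; left; lia.
Qed.

Lemma uw_ltDr z x y : (x + z < y + z) = (x < y).
Proof.
by apply/idP/idP => [/(uw_ltD (- z))|/uw_ltD]; rewrite ?addrK.
Qed.

Lemma uw_leDr z x y : (x + z <= y + z) = (x <= y).
Proof. by rewrite !le_eqVlt uw_ltDr (inj_eq (addIr z)). Qed.

Lemma uw_leD x y x' y' : x <= y -> x' <= y' -> x + x' <= y + y'.
Proof.
move=> h h'; apply: (@le_trans _ _ (y + x')); first by rewrite uw_leDr.
by rewrite ![y + _]addrC uw_leDr.
Qed.

Lemma uw_subr_ge0 x y : (0 <= y - x) = (x <= y).
Proof. by rewrite -[RHS](uw_leDr (- x)) subrr. Qed.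

Lemma uw_subr_gt0 x y : (0 < y - x) = (x < y).
Proof. by rewrite -[RHS](uw_ltDr (- x)) subrr. Qed.

Lemma uw_oppr_ge0 x : (0 <= - x) = (x <= 0).
Proof. by rewrite -uw_subr_ge0 sub0r. Qed.

Lemma uw_oppr_le0 x : (- x <= 0) = (0 <= x).
Proof. by rewrite -uw_oppr_ge0 opprK. Qed.

Lemma uw_ltN x y : (- x < - y) = (y < x).
Proof. by rewrite -[LHS](uw_ltDr (x + y)) addKr addrCA addNr addr0. Qed.

Lemma uw_z_gt0 : 0 < uw_z. Proof. by []. Qed.

Lemma uw_z_muln (n : nat) : uw_z *+ n = (n%:Z, 0).
Proof.
elim: n => [//|n ih]; rewrite mulrS ih uwDE /= carry0 !addr0.
by congr pair; lia.
Qed.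

Lemma uw_shift (k : int) x : x + (k, 0) = (x.1 + k, x.2).
Proof. by rewrite uwDE /= carry0 !addr0. Qed.

Lemma uw_cofinal x : exists n : nat, - (uw_z *+ n) < x < uw_z *+ n.
Proof.
exists (`|x.1|.+2)%N; rewrite uw_z_muln uwNE !uw_ltE /= eqxx /=.
by apply/andP; split; apply/orP; left; lia.
Qed.

Definition proper_convex_subgroup (H : set (uw G)) : Prop :=
  [/\ H 0, (forall x y, H x -> H y -> H (x - y)),
      (forall x y t, H x -> H y -> x <= t <= y -> H t) &
      exists x, ~ H x].

(* This union is itself proper, hence the greatest proper convex subgroup:
   see uw_coreP. *)
Definition uw_core : set (uw G) :=
  \bigcup_(H in [set H | proper_convex_subgroup H]) H.

Definition uw_inf x := forall k : nat, - uw_z < x *+ k < uw_z.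

Lemma proper_convex_inf H x : proper_convex_subgroup H -> H x -> uw_inf x.
Proof.
case=> H0 HB HC [w Hw].
have HN y : H y -> H (- y) by rewrite -sub0r; apply: HB.
have HD y t : H y -> H t -> H (y + t).
  by move=> hy ht; rewrite -[t]opprK; apply: HB => //; apply: HN.
have HM y k : H y -> H (y *+ k).
  by move=> hy; elim: k => // k ih; rewrite mulrS; apply: HD.
have Hz : ~ H uw_z.
  move=> hz; apply: Hw; have [n /andP[/ltW h1 /ltW h2]] := uw_cofinal w.
  by apply: (HC _ _ _ (HN _ (HM _ n hz)) (HM _ n hz)); rewrite h1.
have Hlt y : H y -> y < uw_z.
  move=> hy; rewrite ltNge; apply/negP => h; apply: Hz.
  by apply: (HC 0 y) => //; rewrite h andbT.
move=> hx k; have hk := HM _ k hx; rewrite Hlt// andbT.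
by rewrite -[x *+ k]opprK uw_ltN Hlt//; apply: HN.
Qed.

Lemma inf_proper_convex : proper_convex_subgroup uw_inf.
Proof.
have I0 : uw_inf 0 by move=> k; rewrite mul0rn -{1}oppr0 uw_ltN uw_z_gt0.
have IN x : uw_inf x -> uw_inf (- x).
  move=> hx k; have /andP[h1 h2] := hx k; rewrite mulNrn uw_ltN h2.
  by rewrite -[uw_z]opprK uw_ltN.
have ID x y : uw_inf x -> uw_inf y -> forall k, (x + y) *+ k < uw_z.
  move=> hx hy k; rewrite mulrnDl; have := hx (k * 2)%N; have := hy (k * 2)%N.
  rewrite !mulrnA !mulr2n; case/andP=> _ h1 /andP[_ h2].
  have [h|h] := leP (x *+ k) (y *+ k).
    by apply: le_lt_trans h1; rewrite uw_leDr.
  by apply: le_lt_trans h2; rewrite ![x *+ k + _]addrC uw_leDr ltW.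
have ID' x y : uw_inf x -> uw_inf y -> uw_inf (x + y).
  move=> hx hy k; rewrite ID// andbT -[(x + y) *+ k]opprK uw_ltN -mulNrn opprD.
  by apply: ID; apply: IN.
split=> //.
- by move=> x y hx hy; apply: ID' => //; apply: IN.
- move=> x y t hx hy /andP[xt ty] k.
  have M (u v : uw G) : u <= v -> u *+ k <= v *+ k.
    by move=> uv; elim: k => // k ih; rewrite !mulrS uw_leD.
  have /andP[h1 _] := hx k; have /andP[_ h2] := hy k.
  by rewrite (lt_le_trans h1 (M _ _ xt)) (le_lt_trans (M _ _ ty) h2).
- by exists uw_z => /(_ 1%N); rewrite mulr1n ltxx andbF.
Qed.

Lemma uw_core_inf : uw_core = uw_inf.
Proof.
apply/seteqP; split=> x /=; first by case=> H /= /proper_convex_inf; apply.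
by move=> hx; exists uw_inf => //; apply: inf_proper_convex.
Qed.

Lemma uw_coreP : proper_convex_subgroup uw_core /\
  forall H, proper_convex_subgroup H -> H `<=` uw_core.
Proof.
split; first by rewrite uw_core_inf; apply: inf_proper_convex.
by move=> H hH x hx; exists H.
Qed.

Lemma uw_core_bound x : uw_core x -> - uw_z < x < uw_z.
Proof. by rewrite uw_core_inf => /(_ 1%N). Qed.

Lemma uw_core_inj x y : uw_core x -> uw_core y -> x.2 = y.2 -> x = y.
Proof.
move=> hx hy e; have [[_ hB _ _] _] := uw_coreP.
have /uw_core_bound := hB _ _ hx hy.
rewrite uwDE uwNE /= e subrr !uw_ltE /= eqxx !oppr0 clt_irr !andbF !orbF.
rewrite carryC /carry addNr clt0l oppr_eq0.
rewrite [x]surjective_pairing [y]surjective_pairing e /=.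
by case: (y.2 != 0) => /= h; congr pair; lia.
Qed.

(* The image of uw_core under the projection uw G -> G *)
Definition linear_part : {pred G} :=
  fun a => `[< exists2 x, uw_core x & x.2 = a >].

Lemma linear_part_zmod_closed : zmod_closed linear_part.
Proof.
have [[h0 hB _ _] _] := uw_coreP.
split=> [|a b]; first by apply/asboolP; exists 0.
move=> /asboolP[x hx <-] /asboolP[y hy <-]; apply/asboolP.
by exists (x - y); [apply: hB|rewrite uwDE uwNE].
Qed.

HB.instance Definition _ :=
  GRing.isZmodClosed.Build G linear_part linear_part_zmod_closed.

End Unwound.

(* l(G) as a group with the order inherited from uw G; an element of l(G) has a
   unique lift to uw_core, by uw_core_inj. *)
Definition linG (G : cycZmodType) : Type := {a : G | a \in linear_part (G := G)}.

HB.instance Definition _ G := SubChoice.on (linG G).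
HB.instance Definition _ G := [SubChoice_isSubZmodule of linG G by <:].

Section Lin.
Variable G : cycZmodType.
Implicit Types a b c : linG G.

Definition lin_lt a b : bool := `[< exists x y : uw G,
  [/\ uw_core x, uw_core y, x.2 = \val a, y.2 = \val b & x < y] >].

Definition lin_le a b : bool := (a == b) || lin_lt a b.

Lemma lin_lift a : exists2 x : uw G, uw_core x & x.2 = \val a.
Proof. by have /asboolP := valP a. Qed.

Lemma lin_lt_irr : irreflexive lin_lt.
Proof.
move=> a; apply/asboolP => -[x [y [hx hy ex ey]]].
by rewrite (uw_core_inj hx hy) ?ltxx// ex.
Qed.

Lemma lin_lt_trans : transitive lin_lt.
Proof.
move=> b a c /asboolP[x [y [hx hy ex ey xy]]] /asboolP[y' [t [hy' ht ey' et yt]]].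
apply/asboolP; exists x, t; split=> //; apply: lt_trans xy _.
by rewrite (uw_core_inj hy hy')// ey.
Qed.

Lemma lin_lt_total a b : a != b -> lin_lt a b || lin_lt b a.
Proof.
have [x hx ex] := lin_lift a; have [y hy ey] := lin_lift b.
move=> ab; have : x != y by apply: contra ab => /eqP h; rewrite -val_eqE -ex h ey.
case: ltgtP => // h _; apply/orP; [left|right]; apply/asboolP.
  by exists x, y.
by exists y, x.
Qed.

HB.instance Definition _ := Order.LtOrder.Build ring_display (linG G)
  (fun _ _ => erefl : lin_le _ _ = _) (fun _ _ => erefl) (fun _ _ => erefl)
  lin_lt_irr lin_lt_trans lin_lt_total.

End Lin.

(* K(G) = G / l(G) *)
Definition KG (G : cycZmodType) : Type := Quotient.quot (linear_part (G := G)).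

HB.instance Definition _ G := GRing.Zmodule.on (KG G).
HB.instance Definition _ G := EqQuotient.on (KG G).

Section KG.
Variable G : cycZmodType.
Implicit Types (a b c h : G) (p q r t : KG G).
Local Notation l := (linear_part (G := G)).

(* By KG_cyc_pi this does not depend on the representatives. *)
Definition KG_cyc p q r : bool :=
  [&& p != q, q != r, p != r & cyc (repr p) (repr q) (repr r)].

Lemma KG_eq a b : (\pi_(KG G) a == \pi b) = (a - b \in l).
Proof. by rewrite -Quotient.idealrBE. Qed.

Lemma linear_part_lift a : a \in l -> exists2 x : uw G, uw_core x & x.2 = a.
Proof. by move/asboolP. Qed.

Lemma linear_part_core (x : uw G) : uw_core x -> x.2 \in l.
Proof. by move=> hx; apply/asboolP; exists x. Qed.

Lemma cyc_shift h a b c : h \in l -> a - b \notin l -> b - c \notin l ->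
  a - c \notin l -> cyc a b c -> cyc (a + h) b c.
Proof.
move=> hl nab nbc nac abc.
have ne u v : u - v \notin l -> u != v.
  by apply: contra => /eqP->; rewrite subrr rpred0.
have nahb : a + h - b \notin l by rewrite addrAC rpredDr.
have nahc : a + h - c \notin l by rewrite addrAC rpredDr.
case: (boolP (cyc _ _ _)) => // nR.
have acb : cyc (a + h) c b.
  have := @cyc_total _ (a + h) b c.
  by rewrite (negPf nR) ![_ == a + h]eq_sym !ne//; apply.
have h1 : clt (c - b) (a - b).
  rewrite cltE ?subr_eq0 1?eq_sym ?ne// -(cycDrE b) add0r !subrK.
  by rewrite -cyc_rotE.
have h2 : clt (a + h - b) (c - b).
  rewrite cltE ?subr_eq0 ?ne// -(cycDrE b) add0r !subrK.
  by rewrite cyc_rotE.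
set X : uw G := (0, a + h - b); set Y : uw G := (0, c - b).
set Z : uw G := (0, a - b).
have XY : X < Y by rewrite uw_ltE /= h2.
have YZ : Y < Z by rewrite uw_ltE /= h1.
have X0 : 0 <= X by rewrite le_eqVlt uw_ltE /= clt0l subr_eq0 ne ?orbT.
have Zz : Z < uw_z G by rewrite uw_ltE.
have ZX0 : 0 < Z - X by rewrite uw_subr_gt0; apply: lt_trans YZ.
have ZXz : Z - X < uw_z G.
  apply: le_lt_trans Zz; rewrite -[leRHS]addr0 ![Z + _]addrC uw_leDr.
  by rewrite uw_oppr_le0.
have [W hW eW] : exists2 W : uw G, uw_core W & W.2 = - h.
  by apply: linear_part_lift; rewrite rpredN.
have e2 : (Z - X).2 = - h.
  by rewrite uwDE uwNE /= [a + h - b]addrAC [- (_ + h)]opprD addrA subrr add0r.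
have [[hC0 hCB hCc _] _] := uw_coreP G.
have eZX : Z - X = W + ((Z - X).1 - W.1, 0).
  by rewrite uw_shift eW -e2 [W.1 + _]addrC subrK -surjective_pairing.
have /uw_core_bound := hW.
rewrite (_ : - uw_z G = (-1, 0)); last by rewrite uwNE /= eqxx !oppr0.
move: ZX0 ZXz eZX; rewrite !uw_ltE /= !clt0r eW !andbF !orbF.
set k := (Z - X).1; set w := W.1 => k0 k1 eZX w01.
have [kw|kw] : k - w = 0 \/ k - w = 1.
  move: k0 k1 w01; clear; move: k w (clt _ _) (clt _ _) => k w [] []; lia.
  have hZX : uw_core (Z - X) by rewrite eZX kw (_ : (0, 0) = 0 :> uw G) ?addr0.
  have hYX : uw_core (Y - X).
    apply: (hCc _ _ _ hC0 hZX); rewrite uw_subr_ge0 uw_leDr.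
    by rewrite !ltW.
  have := linear_part_core hYX; rewrite uwDE uwNE /= => hl'.
  case/negP: nahc; rewrite -rpredN.
  by move: hl'; rewrite !opprB addrA subrK.
have hZX : uw_core (Z - X - uw_z G).
  by rewrite eZX kw -/(uw_z G) addrK.
have hX : uw_core (- X).
  apply: (hCc _ _ _ hZX hC0); rewrite uw_oppr_le0 X0 andbT.
  by rewrite addrAC -{2}[- X]add0r uw_leDr -(uw_leDr (uw_z G)) subrK add0r ltW.
by case/negP: nahb; rewrite -rpredN; apply: (linear_part_core hX).
Qed.

Lemma KG_cyc_pi a b c : KG_cyc (\pi a) (\pi b) (\pi c) =
  [&& \pi_(KG G) a != \pi b, \pi_(KG G) b != \pi c, \pi_(KG G) a != \pi c &
      cyc a b c].
Proof.
suff S a' b' c' a1 b1 c1 : a' - a1 \in l -> b' - b1 \in l -> c' - c1 \in l ->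
    a1 - b1 \notin l -> b1 - c1 \notin l -> a1 - c1 \notin l ->
    cyc a1 b1 c1 -> cyc a' b' c'.
  have re d : repr (\pi_(KG G) d) - d \in l by rewrite -KG_eq reprK.
  rewrite /KG_cyc !KG_eq; apply/and4P/and4P => -[n1 n2 n3 h]; split=> //.
    have re' d : d - repr (\pi_(KG G) d) \in l by rewrite -KG_eq reprK.
    by apply: (S _ _ _ _ _ _ (re' a) (re' b) (re' c)) h;
      rewrite -KG_eq !reprK KG_eq.
  exact: (S _ _ _ _ _ _ (re a) (re b) (re c)) h.
have S1 x y b0 c0 : x - y \in l -> y - b0 \notin l -> b0 - c0 \notin l ->
    y - c0 \notin l -> cyc y b0 c0 -> cyc x b0 c0.
  by move=> hl n1 n2 n3 h; rewrite -(subrK y x) addrC; apply: cyc_shift.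
have nC x y : (x - y \notin l) = (y - x \notin l) by rewrite -rpredN opprB.
have nS x y d : x - y \in l -> (x - d \in l) = (y - d \in l).
  by move=> h; rewrite -(subrK y x) -addrA rpredDl.
move=> ha hb hc n1 n2 n3 h.
have ha1 : cyc a' b1 c1 by apply: S1 ha n1 n2 n3 h.
have hb1 : cyc b' c1 a'.
  apply: S1 hb _ _ _ _ => //; last by rewrite -cyc_rotE.
    by rewrite nC (nS _ _ _ ha).
  by rewrite nC (nS _ _ _ ha).
have hc1 : cyc c' a' b'.
  apply: S1 hc _ _ _ _; last by rewrite -cyc_rotE.
  - by rewrite nC (nS _ _ _ ha).
  - by rewrite (nS _ _ _ ha) nC (nS _ _ _ hb) nC.
  - by rewrite nC (nS _ _ _ hb).
by rewrite -cyc_rotE.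
Qed.

Lemma KG_cyc_neq p q r : KG_cyc p q r -> [/\ p != q, q != r & p != r].
Proof. by case/and4P. Qed.

Lemma KG_cyc_rot p q r : KG_cyc p q r -> KG_cyc q r p.
Proof.
case/and4P => n1 n2 n3 h; apply/and4P.
by rewrite [r == p]eq_sym [q == p]eq_sym; split=> //; apply: cyc_rot.
Qed.

Lemma KG_cyc_trans r p q t : KG_cyc r p q -> KG_cyc r q t -> KG_cyc r p t.
Proof.
case/and4P => n1 n2 n3 h /and4P[n4 n5 n6 h']; apply/and4P; split=> //.
  apply: contraTneq h' => e; rewrite -e cyc_asym//; exact: h.
exact: cyc_trans h h'.
Qed.

Lemma KG_cyc_total r p q : p != r -> q != r -> p != q ->
  KG_cyc r p q || KG_cyc r q p.
Proof.
move=> n1 n2 n3; rewrite /KG_cyc ![r == _]eq_sym n1 n2 n3 [q == p]eq_sym n3 /=.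
have R (u v : KG G) : u != v -> repr u != repr v.
  by apply: contra => /eqP e; rewrite -[u]reprK -[v]reprK e.
by apply: cyc_total; apply: R.
Qed.

Lemma KG_cycDr t p q r : KG_cyc p q r -> KG_cyc (p + t) (q + t) (r + t).
Proof.
elim/quotW: p => a; elim/quotW: q => b; elim/quotW: r => c; elim/quotW: t => u.
rewrite -!raddfD !KG_cyc_pi !KG_eq => /and4P[n1 n2 n3 h].
have e x y : x + u - (y + u) = x - y by rewrite opprD addrACA subrr addr0.
by apply/and4P; rewrite !e; split=> //; apply: cycDr.
Qed.

HB.instance Definition _ := Zmodule_isCyclicallyOrdered.Build (KG G)
  KG_cyc_neq KG_cyc_rot KG_cyc_trans KG_cyc_total KG_cycDr.

End KG.

(* R(s_1, ..., s_m), for m >= 3 *)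
Definition cyc_seq (G : cycZmodType) (s : seq G) : Prop := forall i j k : nat,
  (i < j)%N -> (j < k)%N -> (k < size s)%N -> cyc s`_i s`_j s`_k.

(* The common conclusion of n_regular and c_n_regular; the sequence below is
   0, x, ..., (n - 1) x, xn. *)
Definition cyc_div (G : cycZmodType) (n : nat) (x1 xn : G) : Prop :=
  exists x : G, (cyc x1 (x *+ n) xn \/ x *+ n = x1 \/ x *+ n = xn) /\
    cyc_seq (rcons [seq x *+ i | i <- iota 0 n] xn).

Definition n_regular (G : cycZmodType) (n : nat) : Prop := forall s : n.-tuple G,
  cyc_seq (0 :: rcons s (- last 0 s)) -> cyc_div n s`_0 (last 0 s).

Definition c_n_regular (G : cycZmodType) (n : nat) : Prop := forall s : n.-tuple G,
  cyc_seq (0 :: s) -> cyc_div n s`_0 (last 0 s).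

Definition lo_n_regular (A : porderZmodType) (n : nat) : Prop :=
  forall s : n.-tuple A,
    path <%R 0 s -> exists x : A, s`_0 <= x *+ n <= last 0 s.

Definition c_archimedean (G : cycZmodType) : Prop :=
  forall a : G, a \in linear_part (G := G) -> a = 0.

Definition n_divisible (A : zmodType) (n : nat) : Prop :=
  forall y : A, exists x : A, x *+ n = y.

Section Circle.
Variable R : realType.
Local Open Scope complex_scope.

Definition cis (t : R) : R[i] := cos t +i* sin t.

(* The cyclic order of the unit circle *)
Definition circ (u v w : R[i]) : Prop := exists t1 t2 t3 : R,
  [/\ [/\ 0 <= t1 < pi *+ 2, 0 <= t2 < pi *+ 2 & 0 <= t3 < pi *+ 2],
      [/\ u = cis t1, v = cis t2 & w = cis t3] &
      [|| t1 < t2 < t3, t2 < t3 < t1 | t3 < t1 < t2]].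

(* An embedding of cyclically ordered groups of H in the unit circle *)
Definition cyc_embedding (H : cycZmodType) (f : H -> R[i]) : Prop :=
  [/\ forall p, `|f p| = 1,
      {morph f : p q / p + q >-> p * q},
      injective f &
      forall p q r, cyc p q r <-> circ (f p) (f q) (f r)].

Lemma cisD s t : cis (s + t) = cis s * cis t.
Proof. by rewrite /cis cosD sinD; simpc; congr Complex; ring. Qed.

Lemma cis0 : cis 0 = 1. Proof. by rewrite /cis cos0 sin0. Qed.

Lemma cis2pi : cis (pi *+ 2) = 1. Proof. by rewrite /cis cos2pi sin2pi. Qed.

Lemma norm_cis t : `|cis t| = 1.
Proof. by rewrite normc_def /= cos2Dsin2 sqrtr1. Qed.

Lemma cis_neq0 t : cis t != 0.
Proof. by rewrite -normr_eq0 norm_cis oner_eq0. Qed.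

Lemma cis_eq1 t : 0 <= t < pi *+ 2 -> cis t = 1 -> t = 0.
Proof.
have pi0 := pi_gt0 R.
move=> /andP[t0 t2] /eqP; rewrite eq_complex /= => /andP[/eqP hc /eqP hs].
apply/eqP; rewrite eq_le t0 andbT leNgt; apply/negP => tp.
have [h|h|h] := ltgtP t pi.
- by have := @sin_gt0_pi R t; rewrite tp h hs ltxx => /(_ isT).
- have := @sin_gt0_pi R (t - pi); rewrite subr_gt0 h ltrBlDr -mulr2n t2.
  by move/(_ isT); rewrite -oppr_lt0 -sinDpi subrK hs ltxx.
- by move: hc; rewrite h cospi => /eqP; rewrite -subr_eq0 -opprD oppr_eq0
    -mulr2n pnatr_eq0.
Qed.

Lemma cis_inj s t : 0 <= s < pi *+ 2 -> 0 <= t < pi *+ 2 ->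
  cis s = cis t -> s = t.
Proof.
wlog st : s t / s <= t => [hw|] hs ht e.
  by have [h|/ltW h] := leP s t; [apply: hw|apply/esym/hw].
apply/esym/eqP; rewrite -subr_eq0; apply/eqP/cis_eq1.
  by case/andP: hs => ? ?; case/andP: ht => ? ?; lra.
by apply: (mulfI (cis_neq0 s)); rewrite -cisD addrC subrK mulr1.
Qed.

Lemma circ_neq u v w : circ u v w -> [/\ u <> v, v <> w & u <> w].
Proof.
case=> t1 [t2 [t3 [[h1 h2 h3] [-> -> ->] h]]].
by split=> /cis_inj e; move: h; rewrite e// !ltxx ?andbF ?orbF => /andP[/lt_trans h /h];
  rewrite ltxx.
Qed.

Lemma circ_asym u v w : circ u v w -> ~ circ u w v.
Proof.
case=> t1 [t2 [t3 [[h1 h2 h3] [-> -> ->] h]]].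
case=> s1 [s2 [s3 [[k1 k2 k3] [/cis_inj e1 /cis_inj e2 /cis_inj e3] k]]].
move: h k; rewrite -e1// -e2// -e3//.
by case/or3P => /andP[? ?] /or3P[] /andP[? ?]; lra.
Qed.

Lemma circ_rot u v w : circ u v w -> circ v w u.
Proof.
case=> t1 [t2 [t3 [[h1 h2 h3] [-> -> ->] h]]]; exists t2, t3, t1.
by split=> //; case/or3P: h => ->; rewrite ?orbT.
Qed.

End Circle.

Section Embedding.
Variables (R : realType) (G : cycZmodType).
Implicit Types (x y : uw G) (a b c : G).

Lemma uwD1 x y : (x + y).1 = x.1 + y.1 + (carry x.2 y.2)%:Z.
Proof. by rewrite uwDE. Qed.

Lemma uw_fst_homo x y : x <= y -> x.1 <= y.1.
Proof. by rewrite le_eqVlt => /orP[/eqP->//|/orP[/ltW|/andP[/eqP->]]]. Qed.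

Lemma uw_fst_muln x m :
  x.1 * m.+1%:Z <= (x *+ m.+1).1 < (x.1 + 1) * m.+1%:Z.
Proof.
elim: m => [|m /andP[h1 h2]].
  by rewrite mulr1n; lia.
rewrite mulrS uwD1 (_ : m.+2%:Z = m.+1%:Z + 1); last by lia.
move: h1 h2; rewrite !mulrDr !mulr1 !mulrDl !mul1r.
move: (x.1 * m.+1%:Z) (x *+ _).1 x.1 (carry _ _) m.+1%:Z.
by move=> u v w [] t /= h1 h2; lia.
Qed.

Definition slope x (k : nat) : R := (x *+ k.+1).1%:~R.

(* The order-preserving morphism uw G -> R that maps uw_z to 1; its kernel is
   uw_core. *)
Definition rotnum x : R := sup (range (fun k => slope x k / k.+1%:R)).

Lemma slope_le x j k : slope x j / j.+1%:R <= (slope x k + 1) / k.+1%:R.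
Proof.
rewrite ler_pdivrMr// mulrAC ler_pdivlMr// /slope.
have /andP[h1 _] := uw_fst_muln (x *+ j.+1) k.
have /andP[_ h2] := uw_fst_muln (x *+ k.+1) j.
move: h1 h2; rewrite -!mulrnA mulnC => h1 h2.
have := le_trans h1 (ltW h2).
by rewrite -(ler_int R) !rmorphM rmorphD.
Qed.

Lemma rotnumP x k : slope x k <= rotnum x * k.+1%:R <= slope x k + 1.
Proof.
have ne : range (fun k => slope x k / k.+1%:R) !=set0.
  by exists (slope x 0 / 1%:R); exists 0%N.
rewrite /rotnum; apply/andP; split.
  rewrite -ler_pdivrMr//; apply: ub_le_sup; last by exists k.
  by exists ((slope x 0 + 1) / 1%:R) => _ [j _ <-]; apply: slope_le.
by rewrite -ler_pdivlMr//; apply: ge_sup => // _ [j _ <-]; apply: slope_le.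
Qed.

Lemma archi_le0 (d e : R) : (forall k, d * k.+1%:R <= e) -> d <= 0.
Proof.
move=> h; rewrite leNgt; apply/negP => d0.
have := h (Num.bound `|e / d|); rewrite leNgt => /negP; apply.
rewrite mulrC -ltr_pdivrMr//; apply: le_lt_trans (ler_norm _) _.
by apply: lt_le_trans (archi_boundP (normr_ge0 _)) _; rewrite ler_nat.
Qed.

Lemma uw_muln_shift n k : ((n, 0) : uw G) *+ k = (n * k%:Z, 0).
Proof.
elim: k => [|k ih]; first by rewrite mulr0n mulr0.
by rewrite mulrS ih uw_shift /=; congr pair; lia.
Qed.

Lemma rot_shift n : rotnum (n, 0) = n%:~R.
Proof.
have h k : n%:~R * k.+1%:R <= rotnum (n, 0) * k.+1%:R <= n%:~R * k.+1%:R + 1.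
  by have := rotnumP (n, 0) k; rewrite /slope uw_muln_shift /= intrM.
apply/eqP; rewrite eq_le -subr_le0 -[X in _ && X]subr_le0; apply/andP; split.
  by apply: (@archi_le0 _ 1) => k; have /andP[] := h k; rewrite mulrBl; lra.
by apply: (@archi_le0 _ 0) => k; have /andP[] := h k; rewrite mulrBl; lra.
Qed.

Lemma rotnumD x y : rotnum (x + y) = rotnum x + rotnum y.
Proof.
have h k : slope x k + slope y k <= slope (x + y) k <= slope x k + slope y k + 1.
  rewrite /slope mulrnDl uwD1 !intrD.
  by case: (carry _ _); rewrite /= ?mulr0z ?mulr1z; apply/andP; split; lra.
apply/eqP; rewrite eq_le -subr_le0 -[X in _ && X]subr_le0; apply/andP; split;
  apply: (@archi_le0 _ 2) => k; have /andP[h1 h2] := h k;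
  have /andP[h3 h4] := rotnumP (x + y) k; have /andP[h5 h6] := rotnumP x k;
  have /andP[h7 h8] := rotnumP y k; rewrite mulrBl mulrDl; lra.
Qed.

Lemma rotnum0 : rotnum 0 = 0. Proof. by rewrite (rot_shift 0). Qed.

Lemma rotnumN x : rotnum (- x) = - rotnum x.
Proof. by apply/eqP; rewrite -addr_eq0 -rotnumD addNr rotnum0. Qed.

Lemma rot_homo x y : x <= y -> rotnum x <= rotnum y.
Proof.
move=> xy; rewrite -subr_le0; apply: (@archi_le0 _ 1) => k.
have h : slope x k <= slope y k.
  rewrite /slope ler_int; apply: uw_fst_homo.
  by elim: k.+1 => // m ih; rewrite !mulrS uw_leD.
have /andP[h5 h6] := rotnumP x k; have /andP[h7 h8] := rotnumP y k.
by rewrite mulrBl; lra.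
Qed.

Lemma rot_core x : rotnum x = 0 <-> uw_core x.
Proof.
split=> [hx|].
  have [_ /(_ [set y | rotnum y = 0])] := uw_coreP G; apply => //=.
  split=> /=; first exact: rotnum0.
  - by move=> u v hu hv; rewrite rotnumD rotnumN hu hv subrr.
  - move=> u v t hu hv /andP[/rot_homo h1 /rot_homo h2].
    by apply/eqP; rewrite eq_le -{1}hv h2 -hu.
  - by exists (1, 0) => /=; rewrite rot_shift; apply/eqP; rewrite oner_eq0.
rewrite uw_core_inf => h.
have h' k : -1 <= slope x k <= 0.
  have /andP[h1 h2] := h k.+1; have := uw_fst_homo (ltW h1).
  move: h2; rewrite uwNE /= eqxx subr0 => /orP[|/andP[_]]; last by rewrite clt0r.
  by rewrite /= => h3 h4; rewrite /slope (ler_int _ (-1)) (ler_int _ _ 0); lia.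
apply/eqP; rewrite eq_le -oppr_le0 andbC; apply/andP; split;
  apply: (@archi_le0 _ 1) => k; have /andP[h1 h2] := h' k;
  have /andP[h3 h4] := rotnumP x k; lra.
Qed.

Definition phi a : R := rotnum (0, a).

Lemma phi_ge0 a : 0 <= phi a.
Proof.
have [->|a0] := eqVneq a 0; first by rewrite /phi (rot_shift 0).
by rewrite -rotnum0; apply: rot_homo; apply: ltW; rewrite uw_ltE /= clt0l.
Qed.

Lemma phi_le1 a : phi a <= 1.
Proof.
rewrite -[1]/(1%:~R) -rot_shift; apply: rot_homo; apply: ltW.
by rewrite uw_ltE.
Qed.

Lemma phi_homo a b : clt a b -> phi a <= phi b.
Proof. by move=> ab; apply: rot_homo; apply: ltW; rewrite uw_ltE /= ab. Qed.

Lemma rot_phi x : rotnum x = phi x.2 + x.1%:~R.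
Proof.
rewrite -rot_shift -rotnumD; congr rotnum.
by rewrite uw_shift /= add0r -surjective_pairing.
Qed.

Definition Phi a : R[i] := cis (pi *+ 2 * phi a).

Lemma cis2piM (n : int) : cis (pi *+ 2 * n%:~R) = 1 :> R[i].
Proof.
have N (m : nat) : cis (pi *+ 2 * m%:R) = 1 :> R[i].
  by elim: m => [|m ih]; rewrite ?mulr0 ?cis0// -natr1 mulrDr mulr1 cisD ih cis2pi mulr1.
case: n => m; first exact: N.
rewrite NegzE rmorphN mulrN; apply: (mulfI (cis_neq0 (pi *+ 2 * m.+1%:R))).
by rewrite -cisD subrr cis0 mulr1 N.
Qed.

Lemma PhiD a b : Phi (a + b) = Phi a * Phi b.
Proof.
rewrite /Phi -cisD -mulrDr /phi -rotnumD [in RHS]rot_phi uwDE /=.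
by rewrite [in RHS]mulrDr cisD cis2piM mulr1.
Qed.

Lemma Phi_eq1 a : Phi a = 1 <-> a \in linear_part (G := G).
Proof.
have pi0 := pi_gt0 R.
split=> [h|/asboolP[x /rot_core hx <-]]; last first.
  rewrite rot_phi in hx; rewrite /Phi (_ : phi x.2 = (- x.1)%:~R) ?cis2piM//.
  by apply/eqP; rewrite rmorphN -addr_eq0 hx.
have [h1|h1] := ltP (phi a) 1.
  suff : phi a = 0 by move/rot_core/linear_part_core.
  apply/eqP; rewrite -(@mulrI_eq0 _ (pi *+ 2)).
    apply/eqP/cis_eq1 => //; rewrite mulr_ge0 ?phi_ge0//=; last by lra.
    by rewrite gtr_pMr//; lra.
  by apply/mulfI; rewrite gt_eqF//; lra.
have e : phi a = 1 by apply/eqP; rewrite eq_le phi_le1.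
have : rotnum (-1, a) = 0 by rewrite rot_phi /= e subrr.
by move/rot_core/linear_part_core.
Qed.

Definition KG_emb (p : KG G) : R[i] := Phi (repr p).

Lemma KG_emb_pi a : KG_emb (\pi a) = Phi a.
Proof.
rewrite /KG_emb -[in LHS](subrK a (repr _)) PhiD.
have /Phi_eq1-> : repr (\pi_(KG G) a) - a \in linear_part (G := G).
  by rewrite -KG_eq reprK.
by rewrite mul1r.
Qed.

Lemma KG_embD : {morph KG_emb : p q / p + q >-> p * q}.
Proof.
move=> p q; elim/quotW: p => a; elim/quotW: q => b.
by rewrite -raddfD !KG_emb_pi PhiD.
Qed.

Lemma KG_emb_inj : injective KG_emb.
Proof.
move=> p q; elim/quotW: p => a; elim/quotW: q => b; rewrite !KG_emb_pi => e.
apply/eqP; rewrite KG_eq; apply/Phi_eq1/(mulIf (cis_neq0 (pi *+ 2 * phi b))).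
by rewrite -PhiD subrK mul1r.
Qed.

Lemma Phi_circ a b c : clt a b -> clt b c ->
  Phi a <> Phi b -> Phi b <> Phi c -> Phi a <> Phi c ->
  circ (Phi a) (Phi b) (Phi c).
Proof.
have pi0 := pi_gt0 R; set T : R := pi *+ 2; have T0 : 0 < T by rewrite /T; lra.
move=> /phi_homo ab /phi_homo bc nab nbc nac.
have lt u v : Phi u <> Phi v -> phi u <= phi v -> phi u < phi v.
  by move=> n; rewrite le_eqVlt => /orP[/eqP e|//]; case: n; rewrite /Phi e.
have {}ab := lt _ _ nab ab; have {}bc := lt _ _ nbc bc.
have r u : phi u < 1 -> 0 <= T * phi u < T.
  by move=> h; rewrite mulr_ge0 ?phi_ge0//= ?gtr_pMr// ltW.
have c1 := phi_le1 c.
have [h|h] := ltP (phi c) 1.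
  exists (T * phi a), (T * phi b), (T * phi c); split => //.
    by split; apply: r => //; lra.
  by rewrite !ltr_pM2l// ab bc.
have ec : phi c = 1 by apply/eqP; rewrite eq_le c1.
have e0 : Phi c = cis 0 by rewrite /Phi ec mulr1 cis2pi cis0.
exists (T * phi a), (T * phi b), 0; split => //.
  by split; [apply: r; lra|apply: r; lra|rewrite lexx].
rewrite !ltr_pM2l// ab mulr_gt0 ?orbT// lt_neqAle phi_ge0 andbT.
by apply/eqP => e; apply: nac; rewrite e0 /Phi -e mulr0.
Qed.

Lemma KG_emb_cyc p q r : cyc p q r -> circ (KG_emb p) (KG_emb q) (KG_emb r).
Proof.
elim/quotW: p => a; elim/quotW: q => b; elim/quotW: r => c.
move/[dup]/cyc_neq => -[n1 n2 n3].
rewrite [cyc _ _ _]KG_cyc_pi => /and4P[_ _ _].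
have I u v : \pi_(KG G) u != \pi v -> Phi u <> Phi v.
  by move=> /eqP n; rewrite -!KG_emb_pi => /KG_emb_inj.
move: n1 n2 n3 => /I n1 /I n2 /I n3; rewrite !KG_emb_pi.
rewrite cyc_clt => /or3P[]/andP[h1 h2].
- exact: Phi_circ.
- by apply/circ_rot/circ_rot/Phi_circ => //; apply: nesym.
- by apply/circ_rot/Phi_circ => //; apply: nesym.
Qed.

Lemma KG_embP : cyc_embedding KG_emb.
Proof.
split; [by move=> p; apply: norm_cis|exact: KG_embD|exact: KG_emb_inj|].
move=> p q r; split; first exact: KG_emb_cyc.
move=> h; have [n1 n2 n3] := circ_neq h.
have I u v : KG_emb u <> KG_emb v -> u != v by move=> n; apply/eqP => e; apply: n; rewrite e.
move: n1 n2 n3 => /I n1 /I n2 /I n3.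
have /orP[//|/KG_emb_cyc /circ_asym] : cyc p q r || cyc p r q.
  by apply: cyc_total => //; rewrite eq_sym.
by [].
Qed.

End Embedding.

(* Main.v *)
Require Import Defs.
From mathcomp Require Import all_boot all_order all_algebra.
From mathcomp Require Import generic_quotient.
From mathcomp Require Import all_classical all_reals all_analysis.
From mathcomp Require Import complex.
From mathcomp Require Import zify ring lra.

Import Order.TTheory GRing.Theory Num.Theory.
Local Open Scope classical_set_scope.
Local Open Scope ring_scope.

(* Let rho : uw(G) -> R be the order-preserving morphism with rho(z_G) = 1 and
   kernel the core C, and let Gamma be its image. An embedding of K(G) in the
   circle is unique, so e^{it} lies in K(G) iff t / 2pi lies in Gamma. All four
   assertions are compared with

     (D) l(G) is n-regular and Gamma is n-divisible.

   (D) makes uw(G) n-regular, which is stronger than (3): if rho(x_1) < rho(x_n),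
   density of Gamma gives x; otherwise x_1, ..., x_n lie in one coset of C, which
   contains some n w, and regularity of C applies to the x_i - n w. Conversely,
   regularity applied to y - n c < ... < y - c with 0 < c in C and rho(y) = gamma
   gives x with n rho(x) = gamma for gamma in [0, 1/2]; under (3), y = z_G also
   shows that K(G) is nontrivial. When it is, Gamma contains some delta in
   ]0, 1/2], and Euclidean division by delta then shows that Gamma is
   n-divisible. *)

(** * Arguments on the unit circle and uniqueness of the embedding of K(G) *)

Section CircleEmbeddings.
Set Implicit Arguments.
Unset Strict Implicit.
Variable R : realType.
Implicit Types s t : R.

Lemma pi2_gt0 : 0 < pi *+ 2 :> R.
Proof. by rewrite pmulrn_lgt0// pi_gt0. Qed.

(** Subtracting the integer part of (s - t) / 2pi leaves an angle in [0, 2pi) where [cis] is 1, and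
    such an angle is 0. *)
Lemma cis_eq s t : cis s = cis t -> exists m : int, s = t + pi *+ 2 * m%:~R.
Proof.
have T0 := pi2_gt0; move=> e; set u := (s - t) / (pi *+ 2); exists (Num.floor u).
have eu : s - t = pi *+ 2 * u by rewrite /u mulrC divfK// gt_eqF// pi2_gt0.
have /andP[h1 h2] := floor_itv u.
suff : pi *+ 2 * (u - (Num.floor u)%:~R) = 0.
  by rewrite mulrBr -eu; lra.
apply: cis_eq1.
  move: h2; rewrite intrD => h2.
  by rewrite mulr_ge0 ?gtr_pMr//=; lra.
apply: (mulIf (cis_neq0 (pi *+ 2 * (Num.floor u)%:~R))).
rewrite -cisD -mulrDr subrK mul1r cis2piM -eu.
by apply: (mulIf (cis_neq0 t)); rewrite -cisD subrK e mul1r.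
Qed.

Lemma norm1_cis (z : R[i]) : `|z| = 1 ->
  exists2 t, 0 <= t < 1 & z = cis (pi *+ 2 * t).
Proof.
have pi0 := pi_gt0 R; case: z => a b; rewrite normc_def /= => /complexI h.
have {}h : a ^+ 2 + b ^+ 2 = 1.
  have h0 : 0 <= a ^+ 2 + b ^+ 2 by rewrite addr_ge0 ?sqr_ge0.
  by rewrite -(sqr_sqrtr h0) h expr1n.
have hb : Num.sqrt (1 - a ^+ 2) = `|b| by rewrite -h addrC addKr sqrtr_sqr.
have ha : -1 <= a <= 1.
  by apply/andP; split; have := sqr_ge0 b; move: h; clear; nra.
have [[c0 c1] c2] := (andP (proj1 (acos_def ha)), proj2 (acos_def ha)).
have cs := sin_acos ha; rewrite hb in cs.
suff [t ht e] : exists2 t, 0 <= t < pi *+ 2 & (a +i* b)%C = cis t.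
  exists (t / (pi *+ 2)); last by rewrite mulrC divfK// gt_eqF//; lra.
  case/andP: ht => t0 t1.
  by rewrite divr_ge0//= ?ltr_pdivrMr ?mul1r//; lra.
have [b0|b0] := leP 0 b.
  by exists (acos a); [lra|rewrite /cis c2 cs ger0_norm].
exists (pi *+ 2 - acos a); last first.
  rewrite /cis addrC cosD2pi sinD2pi cosN sinN c2 cs ltr0_norm//.
  by rewrite opprK.
(* Since b < 0, [acos a] is nonzero, which puts 2pi - [acos a] strictly below 2pi. *)
have : acos a != 0.
  by apply/eqP => e; move: cs; rewrite e sin0 => /esym/eqP; rewrite normr_eq0 lt_eqF.
by rewrite neq_lt => /orP[]; lra.
Qed.

(** The angle of [f 0] is 0, so no angle lies below it: of the three rotations allowed by [circ]
    only g 0 < g p < g q can occur. *)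
Lemma clt_emb (H : cycZmodType) (f : H -> R[i]) (g : H -> R) :
  cyc_embedding f -> (forall p, 0 <= g p < 1) ->
  (forall p, f p = cis (pi *+ 2 * g p)) ->
  forall p q, clt p q -> g p < g q.
Proof.
have T0 := pi2_gt0; move=> [_ fD fI fC] g01 fg p q.
have f0 : f 0 = 1.
  have := fD 0 0; rewrite addr0 -[LHS]mulr1 fg => /(mulfI (cis_neq0 _)).
  by move=> <-.
have r u : 0 <= pi *+ 2 * g u < pi *+ 2.
  have /andP[h1 h2] := g01 u.
  by rewrite mulr_ge0 ?gtr_pMr//=; lra.
have g0 : g 0 = 0.
  have /eqP : pi *+ 2 * g 0 = 0 by apply: cis_eq1; rewrite -?fg.
  by rewrite mulf_eq0 => /orP[/eqP|/eqP//]; lra.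
case/orP => [/fC[t1 [t2 [t3 [[h1 h2 h3] []]]]]|/andP[/eqP-> q0]].
  rewrite !fg => /(cis_inj (r _) h1) <- /(cis_inj (r _) h2) <-.
  move=> /(cis_inj (r _) h3) <-.
  rewrite !(ltr_pM2l T0) g0.
  by have := g01 p; have := g01 q; lra.
rewrite g0 lt_neqAle; have /andP[-> _] := g01 q; rewrite andbT.
apply: contra q0 => /eqP e; apply/eqP/fI.
by rewrite !fg -e g0.
Qed.

(* The arguments of f define a morphism uw H -> R mapping uw_z to 1 and every
   x in [0, uw_z) into [0, 1), and rotnum is the only one. *)
Lemma cyc_embedding_Phi (H : cycZmodType) (f : H -> R[i]) :
  cyc_embedding f -> f =1 Phi R (G := H).
Proof.
have T0 := pi2_gt0; move=> hf; have [f1 fD fI fC] := hf.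
have /choice[g hg] p : exists t, (0 <= t < 1) /\ f p = cis (pi *+ 2 * t).
  by have [t ? ?] := norm1_cis (f1 p); exists t.
have g01 p := (hg p).1; have fg p := (hg p).2.
have mono := clt_emb hf g01 fg.
(* The defect is an integer m, and the ranges leave m = -1 or m = 0. By monotonicity of g, a carry
   means g (p + q) < g p, hence m < 0; no carry means g p <= g (p + q), hence m >= 0. *)
have gD p q : g (p + q) = g p + g q - (carry p q)%:R.
  have := fD p q; rewrite !fg -cisD -mulrDr => /cis_eq[m].
  rewrite -mulrDr => /(mulfI (lt0r_neq0 T0)) e.
  have /andP[p0 p1] := g01 p; have /andP[q0 q1] := g01 q.
  have /andP[r0 r1] := g01 (p + q).
  have m1 : -2 < m by rewrite -(ltr_int R) mulrNz; lra.
  have m2 : m < 1 by rewrite -(ltr_int R); lra.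
  suff : m = - (carry p q)%:Z by move=> e'; rewrite e e' mulrNz; lra.
  case: (boolP (carry p q)) => [/mono h|].
    have m3 : m < 0 by rewrite -(ltr_int R); lra.
    by rewrite /=; lia.
  rewrite /carry => nc.
  have h : g p <= g (p + q).
    have [->//|n] := eqVneq (p + q) p.
    by apply/ltW/mono; rewrite clt_neg.
  have m3 : -1 < m by rewrite -(ltr_int R) mulrNz; lra.
  by rewrite /=; lia.
pose F (x : uw H) : R := x.1%:~R + g x.2.
have FD x y : F (x + y) = F x + F y.
  by rewrite /F uwDE /= gD !intrD; case: carry => /=; lra.
have FM x k : F (x *+ k.+1) = F x * k.+1%:R.
  elim: k => [|k ih]; first by rewrite mulr1n mulr1.
  by rewrite mulrS FD ih -[k.+2%:R]natr1; lra.
(* Multiplied by k + 1, both F x and rho(x) lie between [slope x k] and [slope x k] + 1, so they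
   differ by at most 1 / (k + 1) for every k. *)
have Frot x : F x = rotnum R x.
  have h k : `|F x - rotnum R x| * k.+1%:R <= 1.
    have e : 0 <= k.+1%:R :> R by [].
    rewrite -{1}(ger0_norm e) -normrM mulrBl -FM {1}/F.
    have /andP[u0 u1] := g01 (x *+ k.+1).2; have := rotnumP R x k.
    by rewrite ler_norml /slope; lra.
  by have := archi_le0 h; rewrite normr_le0 subr_eq0 => /eqP.
by move=> p; rewrite fg /Phi /phi -Frot /F add0r.
Qed.

(** By uniqueness [f] and [KG_emb] are both the map [Phi] of the cyclically ordered group K(G), and
    [KG_emb] is known on classes. *)
Lemma cyc_embedding_KG (G : cycZmodType) (f : KG G -> R[i]) a :
  cyc_embedding f -> f (\pi a)%qT = Phi R a.
Proof.
by move=> hf; rewrite cyc_embedding_Phi// -(cyc_embedding_Phi (KG_embP R G)) KG_emb_pi.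
Qed.

(** An argument is determined up to a multiple of 2pi, which a shift of the lift by a multiple of
    z_G absorbs. *)
Lemma range_cyc_embedding (G : cycZmodType) (f : KG G -> R[i]) t :
  cyc_embedding f ->
  range f (cis (pi *+ 2 * t)) <-> range (rotnum R (G := G)) t.
Proof.
move=> hf; split=> [[p _]|[x _ <-]].
  elim/quotW: p => a; rewrite (cyc_embedding_KG _ hf) => /cis_eq[m].
  rewrite -mulrDr => /(mulfI (lt0r_neq0 pi2_gt0)) e.
  exists (- m, a) => //; rewrite rot_phi /= e mulrNz.
  by rewrite addrK.
exists (\pi x.2)%qT => //; rewrite (cyc_embedding_KG _ hf) rot_phi mulrDr.
by rewrite cisD cis2piM mulr1.
Qed.

End CircleEmbeddings.

(** * Cyclic sequences of G and increasing sequences of uw(G) *)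

Section CutOrder.
Set Implicit Arguments.
Unset Strict Implicit.
Variable G : cycZmodType.
Implicit Types (a b : G) (r : seq G) (x y z : uw G) (s : seq (uw G)).

Lemma sorted_clt_cyc r : sorted (@clt G) r -> cyc_seq r.
Proof.
move=> rs i j k ij jk kr.
have jr := ltn_trans jk kr; have ir := ltn_trans ij jr.
have h := sorted_ltn_nth (fun b a c => @clt_trans G b a c) 0 rs.
by apply: cyc_clt_dir; apply: h; rewrite ?inE.
Qed.

(** Two entries are required because r_0 != 0 is read off the triple (0, r_0, r_1). *)
Lemma cyc_sorted_clt r : (1 < size r)%N -> cyc_seq (0 :: r) -> path (@clt G) 0 r.
Proof.
move=> r1 hr; apply/(pathP 0) => -[|i] ir.
  by rewrite /= clt0l eq_sym; have /cyc_neq[] := hr 0%N 1%N 2%N isT isT r1.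
by apply/orP; left; apply: (hr 0%N i.+1 i.+2).
Qed.

Lemma uw_ltMn n x y : (0 < n)%N -> x < y -> x *+ n < y *+ n.
Proof.
case: n => // n _ xy; elim: n => // n ih.
rewrite !(mulrS _ n.+1); apply: lt_trans (uw_ltD _ xy) _.
by rewrite ![y + _]addrC uw_ltDr.
Qed.

Lemma uw_leMn n x y : x <= y -> x *+ n <= y *+ n.
Proof. by move=> xy; elim: n => // n ih; rewrite !mulrS uw_leD. Qed.

Lemma uw_lt_Mn n x y : x *+ n < y *+ n -> x < y.
Proof. by rewrite !ltNge; apply: contra => /uw_leMn. Qed.

Lemma uw_ltMnl m n x : 0 < x -> (m < n)%N -> x *+ m < x *+ n.
Proof.
move=> x0 mn; rewrite -(subnK mn) addnS -addSn mulrnDr -{1}[x *+ m]add0r uw_ltDr.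
by have := uw_ltMn (ltn0Sn (n - m.+1)) x0; rewrite mul0rn.
Qed.

Lemma uw_leMnl m n x : 0 < x -> (m <= n)%N -> x *+ m <= x *+ n.
Proof. by move=> x0; rewrite leq_eqVlt => /orP[/eqP->//|/(uw_ltMnl x0)/ltW]. Qed.

Lemma uw_snd_muln n x : (x *+ n).2 = x.2 *+ n.
Proof. by elim: n => // n ih; rewrite !mulrS uwDE /= ih. Qed.

(** The interval [0, z_G) is the copy of G cut at 0; sequences pass between G and uw(G) through
    it. *)
Lemma uw_fst0 x : 0 <= x < uw_z G -> x = (0, x.2).
Proof.
rewrite leNgt !uw_ltE clt0r andbF orbF /= => /andP[h1 h2].
by rewrite [LHS]surjective_pairing; congr pair; lia.
Qed.

Lemma uw_lt_clt a b : (((0, a) : uw G) < (0, b)) = clt a b.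
Proof. by rewrite uw_ltE. Qed.

Lemma uw0_ge0 a : (0 : uw G) <= (0, a).
Proof. by rewrite leNgt uw_ltE /= clt0r. Qed.

Lemma uw0_ltz a : ((0, a) : uw G) < uw_z G.
Proof. by rewrite uw_ltE. Qed.

Lemma sorted_snd s : {in s, forall x, 0 <= x < uw_z G} ->
  sorted <%R s -> sorted (@clt G) [seq x.2 | x <- s].
Proof.
move=> hs; rewrite sorted_map; apply: (@sub_in_sorted _ [in s]); last exact/allP.
by move=> x y /hs/uw_fst0 -> /hs/uw_fst0 ->; rewrite uw_lt_clt.
Qed.

Lemma path_gt0 s x : path <%R 0 s -> x \in s -> 0 < x.
Proof. by move=> /(order_path_min lt_trans)/allP/(_ x). Qed.

Lemma path_le_last s x : path <%R 0 s -> x \in s -> x <= last 0 s.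
Proof.
case/lastP: s => // s y; rewrite -[path _ _ _]/(sorted _ (_ :: _)) -rcons_cons.
rewrite sorted_pairwise; last exact: lt_trans.
rewrite pairwise_rcons last_rcons /= => /andP[/andP[_ /allP sy] _].
by rewrite mem_rcons inE => /orP[/eqP->//|/sy/ltW].
Qed.

End CutOrder.

(** * Regularity of G expressed in uw(G) *)

Section Lifts.
Set Implicit Arguments.
Unset Strict Implicit.
Variables (G : cycZmodType) (n : nat).
Hypothesis n2 : (1 < n)%N.
Implicit Types (a b : G) (r : seq G) (x y z : uw G) (s : seq (uw G)).

(** The witness is (0, a), with a given by [cyc_div]. The multiples 0, a, ..., (n - 1) a increase in
    the cut order, so their sums produce no carry; only the passage to n a may produce one, and k
    records it. *)
Lemma cyc_div_lift x1 xn : 0 <= x1 -> x1 < xn -> xn < uw_z G ->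
  cyc_div n x1.2 xn.2 -> exists x, [/\ 0 < x, x *+ n.-1 < xn &
    exists k : bool, x1 + uw_z G *+ k <= x *+ n <= xn + uw_z G *+ k].
Proof.
move=> x10 x1n xnz [a [ha hs]].
have e1 : x1 = (0, x1.2) by apply: uw_fst0; rewrite x10 (lt_trans x1n).
have en : xn = (0, xn.2) by apply: uw_fst0; rewrite xnz ltW// (le_lt_trans x10).
have : sorted (@clt G) (rcons [seq a *+ i | i <- iota 0 n] xn.2).
  move: hs; rewrite -{1 2}(prednK (ltnW n2)) /=.
  by apply: cyc_sorted_clt; rewrite size_rcons size_map size_iota -ltnS prednK// ltnW.
move=> /(sortedP 0); rewrite size_rcons size_map size_iota => hsort.
have nthE i : (i < n)%N -> (rcons [seq a *+ i | i <- iota 0 n] xn.2)`_i = a *+ i.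
  move=> ilt; rewrite nth_rcons size_map size_iota ilt.
  by rewrite (nth_map 0%N) ?size_iota// nth_iota.
have nthn : (rcons [seq a *+ i | i <- iota 0 n] xn.2)`_n = xn.2.
  by rewrite nth_rcons size_map size_iota ltnn eqxx.
have lift i : (i < n)%N -> ((0, a) : uw G) *+ i = (0, a *+ i).
  elim: i => // i ih ilt; rewrite mulrSr ih 1?ltnW// uwDE /= -mulrSr.
  have := hsort i; rewrite ltnS (ltnW ilt) nthE ?(ltnW ilt)// nthE// => /(_ isT) h.
  by rewrite /carry -mulrSr clt_asym.
have pn : (n.-1 < n)%N by rewrite prednK// ltnW.
exists (0, a); split.
- have := hsort 0%N; rewrite ltnS (ltnW n2) !nthE ?(ltnW n2)// mulr0n => /(_ isT).
  by rewrite mulr1n -[0 < _]/(((0, 0) : uw G) < (0, a)) uw_lt_clt.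
- rewrite lift// en uw_lt_clt.
  by have := hsort n.-1; rewrite prednK ?(ltnW n2)// ltnS leqnn nthn nthE// => /(_ isT).
exists (carry (a *+ n.-1) a).
have -> : ((0, a) : uw G) *+ n = ((0, a *+ n) : uw G) + uw_z G *+ carry (a *+ n.-1) a.
  rewrite -{1 2}(prednK (ltnW n2)) mulrSr lift// uw_z_muln uw_shift uwDE /=.
  by rewrite -mulrSr !add0r.
rewrite !uw_leDr e1 en; move: x1n; rewrite e1 en uw_lt_clt /= => x1n.
case: ha => [|[]->]; last by rewrite lexx ltW ?uw_lt_clt.
  rewrite cyc_clt (clt_asym x1n) andbF !orbF => /andP[h1 h2].
  by rewrite !ltW ?uw_lt_clt.
by rewrite lexx ltW ?uw_lt_clt.
Qed.

Lemma uw_path_fst0 s : path <%R 0 s -> last 0 s < uw_z G ->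
  {in s, forall x, 0 <= x < uw_z G}.
Proof.
move=> ps lz x xs; rewrite (ltW (path_gt0 ps xs)).
exact: le_lt_trans (path_le_last ps xs) lz.
Qed.

Lemma uw_path_clt s : path <%R 0 s -> last 0 s < uw_z G ->
  path (@clt G) 0 [seq x.2 | x <- s].
Proof.
move=> ps lz; apply: (@sorted_snd _ (0 :: s)) => // x.
by rewrite inE => /orP[/eqP->|]; [rewrite lexx|apply: uw_path_fst0].
Qed.

Lemma nth0_lt_last s : (1 < size s)%N -> path <%R 0 s -> s`_0 < last 0 s.
Proof.
move=> s1 /path_sorted ps; rewrite -nth_last.
by apply: (sorted_ltn_nth lt_trans) => //; rewrite ?inE; case: (size s) s1 => [|[]].
Qed.

Lemma c_n_regular_lift s : c_n_regular G n -> size s = n ->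
  path <%R 0 s -> last 0 s < uw_z G -> exists x,
  [/\ 0 < x, x *+ n.-1 < last 0 s & exists k : bool,
      s`_0 + uw_z G *+ k <= x *+ n <= last 0 s + uw_z G *+ k].
Proof.
move=> reg sn ps lz; have s1 : (1 < size s)%N by rewrite sn.
have l0 := nth0_lt_last s1 ps.
have s0 : 0 <= s`_0 by apply/ltW/(path_gt0 ps)/mem_nth/ltnW.
apply: cyc_div_lift => //.
have /reg : cyc_seq (0 :: map_tuple snd (tcast sn (in_tuple s))).
  rewrite /= val_tcast; apply: sorted_clt_cyc; exact: uw_path_clt.
by rewrite /= val_tcast (nth_map 0) ?(ltnW s1)// -(last_map snd).
Qed.

(** Since 2 x_n < z_G, the lift z_G - x_n of -x_n lies above x_n and below z_G, which supplies the
    extra last term in the hypothesis of [n_regular]. *)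
Lemma n_regular_lift s : n_regular G n -> size s = n ->
  path <%R 0 s -> last 0 s *+ 2 < uw_z G ->
  exists2 x, 0 < x & s`_0 <= x *+ n <= last 0 s.
Proof.
move=> reg sn ps lz2; have s1 : (1 < size s)%N by rewrite sn.
have l0 := nth0_lt_last s1 ps.
have s0 : 0 <= s`_0 by apply/ltW/(path_gt0 ps)/mem_nth/ltnW.
have ln : last 0 s < uw_z G - last 0 s.
  by rewrite -(uw_ltDr (last 0 s)) subrK -mulr2n.
have lz : last 0 s < uw_z G.
  apply: lt_trans lz2; rewrite -{1}[last 0 s]mulr1n uw_ltMnl//.
  exact: le_lt_trans l0.
have [x [x0 xn [k]]] : exists x, [/\ 0 < x, x *+ n.-1 < last 0 s &
    exists k : bool, s`_0 + uw_z G *+ k <= x *+ n <= last 0 s + uw_z G *+ k].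
- apply: cyc_div_lift => //.
  have /reg : cyc_seq (0 :: rcons (map_tuple snd (tcast sn (in_tuple s)))
      (- last 0 (map_tuple snd (tcast sn (in_tuple s))))).
    rewrite /= val_tcast; apply: sorted_clt_cyc => /=.
    have -> : - last 0 [seq x.2 | x <- s] = (uw_z G - last 0 s).2.
      by rewrite uwDE uwNE /= add0r (last_map snd _ 0).
    rewrite -map_rcons; apply: uw_path_clt; first by rewrite rcons_path ps.
    by rewrite last_rcons -uw_subr_gt0 subKr (le_lt_trans s0).
  by rewrite /= val_tcast (nth_map 0) ?(ltnW s1)// (last_map snd _ 0).
case: k => [/andP[h _]|]; last by rewrite mulr0n !addr0; exists x.
(* A carry is impossible: n <= 2 (n - 1) gives n x <= 2 (n - 1) x < 2 x_n < z_G. *)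
have := uw_ltMn (isT : (0 < 2)%N) xn; rewrite -mulrnA => h2.
have h3 : x *+ n <= x *+ (n.-1 * 2) by apply: uw_leMnl => //; lia.
have := lt_trans (le_lt_trans h3 h2) lz2; rewrite ltNge => /negP[].
by apply: le_trans h; rewrite mulr1n -{1}[uw_z G]add0r uw_leDr.
Qed.

(** The x found for the lifts (0, x_i) satisfies 0 < x and n x <= x_n < z_G, so the multiples of x
    up to n x never wrap around and their projections keep their order. *)
Lemma c_n_regular_of_uw : lo_n_regular (uw G) n -> c_n_regular G n.
Proof.
move=> reg t ht; have tn : (1 < size t)%N by rewrite size_tuple.
have pt := cyc_sorted_clt tn ht.
set s := map_tuple (fun a => (0, a) : uw G) t.
have ps : path <%R 0 s.
  change (path <%R ((fun a => (0, a) : uw G) 0) [seq (0, a) : uw G | a <- t]).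
  by rewrite path_map; apply: sub_path pt => a b; rewrite /= uw_lt_clt.
have l0 := nth0_lt_last (_ : (1 < size s)%N) ps.
rewrite size_tuple in l0; have {}l0 := l0 n2.
have [x] := reg s ps.
have eh : s`_0 = (0, t`_0) by rewrite (nth_map 0)// ltnW.
have el : last 0 s = (0, last 0 t) by rewrite -(last_map (fun a => (0, a) : uw G)).
move=> /andP[hx1 hx2]; exists x.2.
have xn0 : 0 < x *+ n.
  apply: lt_le_trans hx1; apply: (path_gt0 ps); rewrite mem_nth// size_tuple.
  exact: ltnW.
have x0 : 0 < x by apply: (@uw_lt_Mn _ n); rewrite mul0rn.
have xz i : (i <= n)%N -> 0 <= x *+ i < uw_z G.
  move=> i_n; rewrite -{1}(mul0rn _ i) uw_leMn ?ltW//=.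
  apply: le_lt_trans (uw_leMnl x0 i_n) _; apply: le_lt_trans hx2 _.
  by rewrite el uw0_ltz.
split.
  have := uw_fst0 (xz n (leqnn n)); rewrite uw_snd_muln => e.
  move: hx1 hx2 l0; rewrite eh el e !le_eqVlt !uw_lt_clt.
  case/orP => [/eqP[->]|h1]; first by right; left.
  case/orP => [/eqP[->]|h2]; first by right; right.
  by left; rewrite cyc_clt h1 h2.
have -> : rcons [seq x.2 *+ i | i <- iota 0 n] (last 0 t) =
    [seq y.2 | y <- rcons [seq x *+ i | i <- iota 0 n] (last 0 s)].
  rewrite map_rcons -map_comp el; congr rcons; apply: eq_map => i /=.
  by rewrite uw_snd_muln.
apply/sorted_clt_cyc/sorted_snd.
  apply/allP; rewrite all_rcons el uw0_ge0 uw0_ltz all_map /=.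
  by apply/allP => i; rewrite mem_iota => /andP[_ /ltnW/xz].
rewrite sorted_pairwise; last exact: lt_trans.
rewrite pairwise_rcons -sorted_pairwise; last exact: lt_trans.
apply/andP; split.
  rewrite all_map; apply/allP => i; rewrite mem_iota => /andP[_ i_n].
  exact: lt_le_trans (uw_ltMnl x0 i_n) hx2.
rewrite sorted_map; apply: sub_sorted (iota_ltn_sorted 0 n) => i j.
exact: uw_ltMnl.
Qed.

Lemma c_n_regular_n_regular : c_n_regular G n -> n_regular G n.
Proof.
move=> reg t ht; apply: reg => i j k ij jk kt.
have kt' : (k < (size t).+1)%N by [].
have := ht i j k ij jk; rewrite /= size_rcons -rcons_cons.
rewrite !nth_rcons /= kt' (ltn_trans jk kt') (ltn_trans ij (ltn_trans jk kt')).
by apply; apply: ltnW.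
Qed.

End Lifts.

(** * Regularity of l(G) computed in the core C *)

Section LinearPart.
Set Implicit Arguments.
Unset Strict Implicit.
Variables (R : realType) (G : cycZmodType) (n : nat).
Hypothesis n2 : (1 < n)%N.
Implicit Types (a b : linG G) (x y z : uw G) (s : seq (uw G)).
Local Notation rho := (rotnum R (G := G)).
Local Notation core := (@uw_core G).

Let n0 : (0 < n)%N := ltnW n2.

Lemma rotnumM x k : rho (x *+ k) = rho x * k%:R.
Proof.
elim: k => [|k ih]; first by rewrite rotnum0 mulr0.
by rewrite mulrS rotnumD ih -natr1; ring.
Qed.

Lemma rotnumB x y : rho (x - y) = rho x - rho y.
Proof. by rewrite rotnumD rotnumN. Qed.

Lemma rot_z : rho (uw_z G) = 1. Proof. exact: rot_shift. Qed.

Lemma rot_lt x y : rho x < rho y -> x < y.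
Proof. by rewrite !ltNge; apply: contra => /(@rot_homo R). Qed.

Lemma uw_core0 : core 0. Proof. exact/(rot_core R)/rotnum0. Qed.

Lemma uw_core_between x y z : core x -> core y -> x <= z <= y -> core z.
Proof.
by have [[_ _ h _] _] := uw_coreP G; apply: h.
Qed.

Lemma lin_ltE a b x y : core x -> core y -> x.2 = \val a -> y.2 = \val b ->
  (a < b) = (x < y).
Proof.
move=> hx hy ex ey; apply/asboolP/idP => [[x' [y' [hx' hy' ex' ey']]]|xy].
  by rewrite (uw_core_inj hx hx') ?ex// (uw_core_inj hy hy') ?ey.
by exists x, y.
Qed.

Lemma lin_leE a b x y : core x -> core y -> x.2 = \val a -> y.2 = \val b ->
  (a <= b) = (x <= y).
Proof. by move=> hx hy ex ey; rewrite !leNgt (lin_ltE hy hx ey ex). Qed.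

Lemma lin_val_muln a k : \val (a *+ k) = \val a *+ k.
Proof. by rewrite raddfMn. Qed.

Lemma lo_n_regular_core s : lo_n_regular (linG G) n -> size s = n ->
  path <%R 0 s -> (forall x, x \in s -> core x) ->
  exists2 x, core x & s`_0 <= x *+ n <= last 0 s.
Proof.
(* The default of [insubd] is never met: [h] is only applied to elements of C, which project into
   l(G). *)
move=> reg sn ps cs; pose h x : linG G := insubd 0 x.2.
have hE x : core x -> \val (h x) = x.2.
  by move=> cx; rewrite insubdK//; apply: linear_part_core.
have h0 : h 0 = 0 by apply/val_inj; rewrite hE//; apply: uw_core0.
have pt : path <%R 0 [seq h x | x <- s].
  rewrite -h0 path_map; apply: (@sub_in_path _ (fun x => `[< core x >])) ps.
    by move=> x y /asboolP cx /asboolP cy xy; rewrite /= (lin_ltE cx cy) ?hE.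
  apply/allP => x; rewrite inE => /orP[/eqP->|/cs cx]; apply/asboolP => //.
  exact: uw_core0.
have := reg (map_tuple h (tcast sn (in_tuple s))); rewrite /= val_tcast.
move=> /(_ pt)[a]; have [x cx ex] := lin_lift a.
have s1 : (0 < size s)%N by rewrite sn.
have c0 : core s`_0 by apply/cs/mem_nth.
have cl : core (last 0 s) by apply: cs; rewrite -nth_last mem_nth// prednK.
have cn : core (x *+ n) by apply/(rot_core R); rewrite rotnumM (rot_core R x).2 ?mul0r.
have en : (x *+ n).2 = \val (a *+ n) by rewrite uw_snd_muln ex lin_val_muln.
rewrite (nth_map 0)// -{1}h0 last_map.
by rewrite (lin_leE c0 cn) ?hE// (lin_leE cn cl) ?hE// => ?; exists x.
Qed.

(** Elements of C satisfy 2 x < z_G, so [n_regular_lift] applies to their lifts. Convexity puts n x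
    in C, and then x too because 0 < x <= n x. *)
Lemma n_regular_lin : n_regular G n -> lo_n_regular (linG G) n.
Proof.
move=> reg t pt; have /choice[h hP] : forall a : linG G, exists x, core x /\ x.2 = \val a.
  by move=> a; have [x] := lin_lift a; exists x.
have hc a := (hP a).1; have hv a := (hP a).2.
have h0 : h 0 = 0 by apply: uw_core_inj; rewrite ?hv//; apply: uw_core0.
pose s := map_tuple h t.
have ps : path <%R 0 s.
  rewrite -h0 /= path_map; apply: sub_path pt => a b.
  by rewrite /= -(lin_ltE (hc a) (hc b) (hv a) (hv b)).
have el : last 0 s = h (last 0 t) by rewrite -h0 /= last_map.
have [|x x0 xn] := n_regular_lift n2 reg (size_tuple s) ps.
  by have := hc (last 0 t); rewrite uw_core_inf el => /(_ 2%N)/andP[].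
have cn : core (x *+ n).
  apply: uw_core_between xn; last by rewrite el.
  by rewrite (nth_map 0) ?size_tuple.
have cx : core x.
  apply: (uw_core_between uw_core0 cn); rewrite ltW//= -{1}[x]mulr1n.
  by apply: uw_leMnl.
have vx := linear_part_core cx.
exists (Sub x.2 vx); have en : (x *+ n).2 = \val ((Sub x.2 vx : linG G) *+ n).
  by rewrite lin_val_muln SubK uw_snd_muln.
rewrite (lin_leE (hc _) cn (hv _) en) (lin_leE cn (hc _) en (hv _)) -el.
by move: xn; rewrite /s /= (nth_map 0)// size_tuple.
Qed.

End LinearPart.

(** * Divisibility of Gamma and regularity of uw(G) *)

Section Divisibility.
Set Implicit Arguments.
Unset Strict Implicit.
Variables (R : realType) (G : cycZmodType) (n : nat).
Hypothesis n2 : (1 < n)%N.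
Implicit Types (x y z c d : uw G) (s : seq (uw G)).
Local Notation rho := (rotnum R (G := G)).
Local Notation core := (@uw_core G).

Let n0 : (0 < n)%N := ltnW n2.

Lemma lo_n_regular_uw c : core c -> 0 < c -> lo_n_regular (linG G) n ->
  (forall x, exists y, rho y * n%:R = rho x) -> lo_n_regular (uw G) n.
Proof.
move=> cc c0 reg div t pt; have nR : 0 < n%:R :> R by rewrite ltr0n.
have lt1 : t`_0 < last 0 t by apply: nth0_lt_last; rewrite ?size_tuple.
have [lt|le] := ltP (rho t`_0) (rho (last 0 t)).
  have t0 : 0 <= rho t`_0.
    rewrite -(rotnum0 R G); apply/rot_homo/ltW/(path_gt0 pt).
    by rewrite mem_nth ?size_tuple.
  have e0 : 0 < rho (last 0 t) - rho t`_0 by rewrite subr_gt0.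
  (* Dividing z_G repeatedly by n yields arbitrarily small positive elements of Gamma. *)
  have pow k : exists y, rho y = (n%:R ^+ k)^-1.
    elim: k => [|k [y ih]]; first by exists (uw_z G); rewrite rot_z invr1.
    have [w hw] := div y; exists w; rewrite exprSr invfM -ih -hw.
    by rewrite mulfK ?gt_eqF.
  have [y hy] := pow (Num.bound (rho (last 0 t) - rho t`_0)^-1).
  set N : R := n%:R ^+ _ in hy.
  have N0 : 0 < N by rewrite exprn_gt0.
  have ylt : rho y < rho (last 0 t) - rho t`_0.
    rewrite hy invf_plt ?posrE//; apply: lt_le_trans (archi_boundP _) _.
      by rewrite invr_ge0 ltW.
    by rewrite /N -natrX ler_nat ltnW// ltn_expl.
  have y0 : 0 < rho y by rewrite hy invr_gt0.
  (* The first multiple of rho(y) beyond rho(x_1) stays below rho(x_n), as rho(y) is less than the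
     gap; its n-th part is the solution. *)
  have /truncn_itv/andP[h1 h2] : 0 <= rho t`_0 / rho y by rewrite divr_ge0// ltW.
  have [x hx] := div (y *+ (Num.truncn (rho t`_0 / rho y)).+1).
  move: h1 h2; rewrite ler_pdivlMr// ltr_pdivrMr// => h1 h2.
  rewrite rotnumM in hx; exists x.
  have l1 : rho t`_0 < rho (x *+ n) by rewrite rotnumM hx mulrC.
  have l2 : rho (x *+ n) < rho (last 0 t).
    by rewrite rotnumM hx -natr1; lra.
  by rewrite (ltW (rot_lt l1)) (ltW (rot_lt l2)).
(* From here on rho is constant on the sequence, and n w lies in its coset of C. *)
have [w hw] := div t`_0.
have cw : core (t`_0 - w *+ n) by apply/(rot_core R); rewrite rotnumB rotnumM hw subrr.
(* Regularity of l(G) concerns positive sequences only, so the translation by n w is corrected by n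
   d with d in C. If v = x_1 - n w is nonnegative, d = -c does; otherwise v - c is negative and n (v
   - c) <= v - c < v. *)
have [d cd hd] : exists2 d, core d & d *+ n < t`_0 - w *+ n.
  have cB x y : core x -> core y -> core (x - y).
    by have [[_ h _ _] _] := uw_coreP G; apply: h.
  have neg d : d < 0 -> d *+ n <= d.
    move=> d0; rewrite -uw_subr_ge0 -mulNrn addrC -[X in _ + X]opprK.
    by rewrite uw_subr_ge0 -{1}[- d]mulr1n uw_leMnl// -oppr0 uw_ltN.
  have cN : - c < 0 by rewrite -oppr0 uw_ltN.
  have [h|h] := leP (0 : uw G) (t`_0 - w *+ n).
    exists (- c); first by rewrite -sub0r; apply: cB => //; apply: uw_core0.
    exact: le_lt_trans (neg _ cN) (lt_le_trans cN h).
  set v := _ - _ in cw h *; have vc : v - c < v.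
    by rewrite -{2}[v]addr0 ![v + _]addrC uw_ltDr.
  exists (v - c); first exact: cB.
  exact: le_lt_trans (neg _ (lt_trans vc h)) vc.
pose sh x := x - (w + d) *+ n.
have shE : sh t`_0 = t`_0 - w *+ n - d *+ n by rewrite /sh mulrnDl opprD addrA.
have ps : path <%R 0 [seq sh x | x <- t].
  have hsh : 0 < sh t`_0 by rewrite shE uw_subr_gt0.
  have : sorted <%R [seq sh x | x <- t].
    rewrite sorted_map; apply: sub_sorted (path_sorted pt) => x y.
    by rewrite /= uw_ltDr.
  by case: (tval t) hsh => //= x r ->.
(* Monotonicity squeezes rho of each entry between two equal values. *)
have cs x : x \in [seq sh x | x <- t] -> core x.
  move=> /mapP [y yt ->]; apply/(rot_core R).
  rewrite /sh rotnumB rotnumM rotnumD (rot_core R d).2// addr0 hw.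
  have := @rot_homo R _ _ _ (path_le_last pt yt).
  have : rho t`_0 <= rho y.
    apply: rot_homo; rewrite -[y](nth_index 0 yt).
    apply: (sorted_leq_nth le_trans le_refl) => //; rewrite ?inE ?index_mem//.
      exact: sub_sorted (fun x y : uw G => @ltW _ _ x y) _ (path_sorted pt).
    by rewrite size_tuple.
  by lra.
have sz : size [seq sh x | x <- t] = n by rewrite size_map size_tuple.
have [x _] := lo_n_regular_core R n2 reg sz ps cs.
have -> : last 0 [seq sh x | x <- t] = sh (last 0 t).
  case/lastP: (tval t) lt1 => [|r y _]; first by rewrite /= ltxx.
  by rewrite map_rcons !last_rcons.
rewrite (nth_map 0) ?size_tuple// => h; exists (x + (w + d)).
rewrite mulrnDl -[t`_0](subrK ((w + d) *+ n)) uw_leDr.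
by rewrite -[last 0 t](subrK ((w + d) *+ n)) uw_leDr.
Qed.

(** For c in C all entries have the same rho as y, so n x between the first and the last forces n
    rho(x) = rho(y). *)
Definition steps_below c y := mkseq (fun i => y - c *+ (n - i)) n.

Lemma nth0_steps_below c y : (steps_below c y)`_0 = y - c *+ n.
Proof. by rewrite nth_mkseq// subn0. Qed.

Lemma last_steps_below c y : last 0 (steps_below c y) = y - c.
Proof.
rewrite -nth_last size_mkseq nth_mkseq ?prednK//.
by rewrite -subn1 subKn// mulr1n.
Qed.

Lemma path_steps_below c y : 0 < c -> c *+ n < y -> path <%R 0 (steps_below c y).
Proof.
move=> c0 cy; apply/(pathP 0) => -[|i]; rewrite size_mkseq => ilt.
  by rewrite /= nth0_steps_below uw_subr_gt0.
rewrite /= !nth_mkseq ?(ltnW ilt)// ![y - _]addrC uw_ltDr uw_ltN.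
by apply: uw_ltMnl => //; lia.
Qed.

Lemma n_regular_div c : core c -> 0 < c -> n_regular G n ->
  forall x, 0 <= rho x <= 2^-1 -> exists y, rho y * n%:R = rho x.
Proof.
move=> cc c0 reg x /andP[]; rewrite le_eqVlt => /orP[/eqP<- _|x0 x1].
  by exists 0; rewrite rotnum0 mul0r.
have rc : rho c = 0 by apply/rot_core.
(* The lift must satisfy 2 y <= z_G. This can only fail for x when rho(x) = 1/2; then d = 2 x - z_G
   is a nonnegative element of C, and 2 (x - d) = z_G - d. *)
have [y hy yz] : exists2 y, rho y = rho x & y *+ 2 <= uw_z G.
  have [h|/ltW h] := leP (x *+ 2) (uw_z G); first by exists x.
  pose d := x *+ 2 - uw_z G; have xd : x *+ 2 = uw_z G + d by rewrite addrC subrK.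
  have d0 : rho d = 0.
    by have := @rot_homo R _ _ _ h; rewrite rotnumB rotnumM rot_z; lra.
  exists (x - d); first by rewrite rotnumB d0 subr0.
  rewrite mulrnBl xd mulr2n opprD addrA addrK -uw_subr_ge0 subKr.
  by rewrite uw_subr_ge0.
have cy : c *+ n < y by apply: (@rot_lt R); rewrite rotnumM rc mul0r hy.
have [|z z0] := n_regular_lift n2 reg (size_mkseq _ _) (path_steps_below c0 cy).
  rewrite last_steps_below mulrnBl; apply: lt_le_trans yz.
  rewrite -{2}[y *+ 2]addr0 ![y *+ 2 + _]addrC uw_ltDr -oppr0 uw_ltN.
  by have := uw_ltMnl c0 (isT : (0 < 2)%N).
rewrite nth0_steps_below last_steps_below => /andP[/(@rot_homo R) h1 /(@rot_homo R) h2].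
exists z; move: h1 h2; rewrite !rotnumB !rotnumM rc; lra.
Qed.

End Divisibility.

(** * Roots of unity and nontriviality of K(G) *)

Section Quotient.
Set Implicit Arguments.
Unset Strict Implicit.
Variables (R : realType) (G : cycZmodType) (n : nat).
Hypothesis n2 : (1 < n)%N.
Implicit Types (x y z c d : uw G) (p q : KG G).
Local Notation rho := (rotnum R (G := G)).
Local Notation core := (@uw_core G).

Let n0 : (0 < n)%N := ltnW n2.

Lemma Phi_rot x : Phi R x.2 = cis (pi *+ 2 * rho x).
Proof. by rewrite rot_phi mulrDr cisD cis2piM mulr1. Qed.

Lemma cisX (t : R) k : cis t ^+ k = cis (t * k%:R).
Proof.
elim: k => [|k ih]; first by rewrite expr0 mulr0 cis0.
by rewrite exprS ih -cisD -natr1; congr cis; ring.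
Qed.

Lemma prim_root_cis : n.-primitive_root (cis (pi *+ 2 / n%:R : R)).
Proof.
have nR : 0 < n%:R :> R by rewrite ltr0n.
have T0 := pi2_gt0 R.
rewrite /primitive_root_of_unity n0; apply/forallP => -[i ilt] /=.
rewrite unity_rootE cisX; apply/eqP; apply/eqP/eqP => [|->]; last first.
  by rewrite divfK ?gt_eqF// cis2pi.
rewrite -mulrA => /eqP; rewrite -(cis0 R) => /eqP/cis_eq[m].
(* Here (i + 1) / n is a positive integer m, hence at least 1, whereas i < n. *)
rewrite add0r => /(mulfI (lt0r_neq0 T0)) e; have m0 : (0 < m)%R.
  by rewrite -(ltr0z R) -e mulr_gt0 ?invr_gt0.
have m1 : 1 <= m%:~R :> R by rewrite (ler_int R 1) -gtz0_ge1.
rewrite -e mulrC ler_pdivlMr// mul1r ler_nat in m1.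
by apply/eqP; rewrite eqn_leq ilt.
Qed.

(** A representative outside l(G) has [phi] strictly between 0 and 1; if the value exceeds 1/2,
    subtracting from z_G reflects it. *)
Lemma KG_nontrivial : (exists p, p != 0) -> exists x, 0 < rho x <= 2^-1.
Proof.
case=> p; elim/quotW: p => a; rewrite -(raddf0 (\pi_(KG G))%qT) KG_eq subr0 => na.
have nPhi : Phi R a <> 1 by move/Phi_eq1; apply/negP.
have T0 := pi2_gt0 R.
have p0 : phi R a != 0 by apply/eqP => e; apply: nPhi; rewrite /Phi e mulr0 cis0.
have p1 : phi R a != 1 by apply/eqP => e; apply: nPhi; rewrite /Phi e mulr1 cis2pi.
have {}p0 : 0 < phi R a by rewrite lt_neqAle eq_sym p0 phi_ge0.
have {}p1 : phi R a < 1 by rewrite lt_neqAle p1 phi_le1.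
have [h|h] := leP (phi R a) 2^-1; first by exists (0, a); rewrite -[rho _]/(phi R a) p0.
exists (uw_z G - ((0, a) : uw G)); rewrite rotnumB rot_z -[rho (0, a)]/(phi R a).
by apply/andP; split; lra.
Qed.

Lemma KG_trivial x : (forall p, p = 0) -> exists m : int, rho x = m%:~R.
Proof.
move=> h; have T0 := pi2_gt0 R.
have /Phi_eq1 : x.2 \in linear_part (G := G).
  by rewrite -[x.2]subr0 -KG_eq (h (\pi x.2)%qT) raddf0.
move=> /(_ R); rewrite Phi_rot -(cis0 R) => /cis_eq[m].
by rewrite add0r => /(mulfI (lt0r_neq0 T0)); exists m.
Qed.

(** If K(G) were trivial, rho would take integer values. The x obtained from z_G - n c < ... < z_G -
    c would have rho(x) = m with m (n - 1) <= 1 and m n = 1 + k, which leaves n = 2 and m = k = 1.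
    Then x < z_G - c contradicts 2 z_G - 2 c <= 2 x. *)
Lemma c_n_regular_KG c : core c -> 0 < c -> c_n_regular G n ->
  exists p : KG G, p != 0.
Proof.
move=> cc c0 reg; apply: contrapT => /forallNP np.
have tr p : p = 0 by apply/eqP; apply: contrapT => /negP; apply: np.
have rc : rho c = 0 by apply/rot_core.
have cz : c *+ n < uw_z G by apply: (@rot_lt R); rewrite rotnumM rc mul0r rot_z.
have [|x [x0 x1 [k]]] := c_n_regular_lift n2 reg (size_mkseq _ _) (path_steps_below n2 c0 cz).
  by rewrite last_steps_below// -uw_subr_gt0 subKr.
move: x1; rewrite nth0_steps_below// last_steps_below// => x1 /andP[h1 h2].
have [m hm] := KG_trivial x tr.
have e1 : m * n.-1%:Z <= 1.
  have := @rot_homo R _ _ _ (ltW x1).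
  by rewrite rotnumB rotnumM rot_z rc hm subr0 -(ler_int R) intrM.
have e2 : m * n%:Z = 1 + k%:Z.
  have := @rot_homo R _ _ _ h1; have := @rot_homo R _ _ _ h2.
  rewrite !rotnumD !rotnumN !rotnumM rot_z rc hm !mul0r oppr0 !addr0 mul1r.
  by move=> l1 l2; apply/eqP; rewrite -(eqr_int R) intrM intrD eq_le l1 l2.
have n_2 : n = 2%N.
  have e3 : m * n%:Z <= m + 1.
    by move: e1; rewrite -{2}(prednK n0) -addn1 PoszD mulrDr mulr1; lia.
  have m0 : 0 < m by rewrite -(pmulr_lgt0 (x := n%:Z))// e2; lia.
  have h3 : m * 2 <= m * n%:Z by rewrite ler_pM2l.
  have m1 : m = 1 by lia.
  by move: e2; rewrite m1 mul1r; case: k {h1 h2} => /=; lia.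
have k1 : k = true by move: e2; rewrite n_2; case: k {h1 h2} => //=; lia.
move: x1 h1; rewrite n_2 k1 /= mulr1n => /(uw_ltMn (isT : (0 < 2)%N)) h /le_lt_trans/(_ h).
by rewrite mulrnBl mulr1n mulr2n addrAC ltxx.
Qed.

End Quotient.

(** * Divisibility of Gamma and of K(G) *)

Section KDivisibility.
Set Implicit Arguments.
Unset Strict Implicit.
Variables (R : realType) (G : cycZmodType) (n : nat) (f : KG G -> R[i]).
Hypotheses (hf : cyc_embedding f) (n2 : (1 < n)%N).
Local Notation rho := (rotnum R (G := G)).

Let n0 : (0 < n)%N := ltnW n2.

Lemma rotnumMz x (m : int) : rho (x *~ m) = rho x * m%:~R.
Proof.
case: m => m; first exact: rotnumM.
by rewrite NegzE !mulrNz rotnumN mulrN; congr (- _); apply: rotnumM.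
Qed.

Lemma rot_div : (exists p : KG G, p != 0) ->
  (forall x, 0 <= rho x <= 2^-1 -> exists y, rho y * n%:R = rho x) ->
  forall x, exists y, rho y * n%:R = rho x.
Proof.
move=> /KG_nontrivial-/(_ R)[d /andP[d0 d1]] div x.
(* The remainder x - q d has rho in [0, rho(d)), hence in [0, 1/2], so [div] applies both to it and
   to d. *)
pose q := Num.floor (rho x / rho d).
have [|u hu] := div d; first by rewrite ltW.
have [|v hv] := div (x - d *~ q).
  have := floor_itv (rho x / rho d).
  rewrite ler_pdivlMr// ltr_pdivrMr// rotnumB rotnumMz -/q intrD mulrDl.
  by rewrite mulrC; lra.
exists (v + u *~ q); rewrite rotnumD rotnumMz mulrDl hv mulrAC hu.
by rewrite rotnumB rotnumMz subrK.
Qed.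

(** With t = 2pi rho(x), the range [0, pi] for t becomes [0, 1/2] for rho(x). *)
Lemma range_div : (forall t : R, 0 <= t <= pi ->
    range f (cis t) -> range f (cis (t / n%:R))) <->
  (forall x, 0 <= rho x <= 2^-1 -> exists y, rho y * n%:R = rho x).
Proof.
have T0 := pi2_gt0 R; have nR : n%:R != 0 :> R by rewrite pnatr_eq0 -lt0n.
split=> div.
  move=> x /andP[x0 x1].
  have h : 0 <= pi *+ 2 * rho x <= pi by rewrite (mulr_ge0 (ltW T0) x0) /=;
    have := ler_wpM2l (ltW T0) x1; lra.
  have := div _ h; rewrite -mulrA !range_cyc_embedding// => -[|y _ hy].
    by exists x.
  by exists y; rewrite hy divfK.
move=> t /andP[t0 t1]; have -> : t = pi *+ 2 * (t / (pi *+ 2)).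
  by rewrite mulrC divfK// gt_eqF.
rewrite -mulrA !range_cyc_embedding// => -[x _ hx].
have [|y hy] := div x.
  by rewrite hx (divr_ge0 t0 (ltW T0)) /= ler_pdivrMr//; lra.
by exists y => //; rewrite -hx -hy mulfK.
Qed.

(** Divisibility of K(G) solves n rho(b) = rho(x) only up to an integer m; the root of unity
    supplies u with rho(u) = 1/n, and subtracting m u removes the error. Conversely, the n-th part
    of z_G gives the root. *)
Lemma KG_div : n_divisible (KG G) n /\ (exists p : KG G, n.-primitive_root (f p)) <->
  (forall x, exists y, rho y * n%:R = rho x).
Proof.
have T0 := pi2_gt0 R; have nR : n%:R != 0 :> R by rewrite pnatr_eq0 -lt0n.
have [_ _ fI _] := hf.
split=> [[div [p hp]] x|div].
  (* The n-th root of unity [cis] (2pi / n) is a power of the given primitive one, hence is in the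
     image of [f]. *)
  have [u hu] : exists u, rho u = n%:R^-1.
    suff : range f (cis (pi *+ 2 / n%:R)).
      by rewrite range_cyc_embedding// => -[u _]; exists u.
    have := prim_rootP hp (prim_expr_order (prim_root_cis R n2)).
    case=> i ->; exists (p *+ i) => //; elim: (i : nat) => [|k ih].
      rewrite mulr0n expr0 -(raddf0 (\pi_(KG G))%qT) (cyc_embedding_KG _ hf).
      exact/Phi_eq1/rpred0.
    by have [_ fD _ _] := hf; rewrite mulrS fD ih exprS.
  have [q hq] := div (\pi x.2)%qT; move: hq; elim/quotW: q => b hq.
  have : Phi R (b *+ n) = Phi R x.2.
    by rewrite -!(cyc_embedding_KG _ hf) raddfMn hq.
  rewrite -[b]/((0, b) : uw G).2 -uw_snd_muln !Phi_rot => /cis_eq[m].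
  rewrite -mulrDr => /(mulfI (lt0r_neq0 T0)); rewrite rotnumM => e.
  exists (((0, b) : uw G) - u *~ m); rewrite rotnumB rotnumMz mulrBl e hu.
  by rewrite mulrAC mulVf// mul1r addrK.
split.
  move=> q; elim/quotW: q => a; have [y hy] := div (0, a).
  exists (\pi y.2)%qT; apply: fI; rewrite -raddfMn !(cyc_embedding_KG _ hf).
  by rewrite -uw_snd_muln -[a]/((0, a) : uw G).2 !Phi_rot rotnumM hy.
have [y hy] := div (uw_z G); exists (\pi y.2)%qT.
rewrite (cyc_embedding_KG _ hf) Phi_rot (_ : rho y = n%:R^-1) ?prim_root_cis//.
by apply: (mulIf nR); rewrite hy rot_z mulVf.
Qed.

End KDivisibility.

(* f is the embedding through which K(G) is identified with a subgroup of the
   unit circle; such an f exists by KG_embP. *)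
Theorem theorem3p7 (R : realType) (G : cycZmodType) (n : nat)
    (f : KG G -> R[i]) (hf : cyc_embedding f)
    (hG : ~ c_archimedean G) (hn : (2 <= n)%N) :
  [<-> n_regular G n /\ (exists p : KG G, p != 0);
       [/\ lo_n_regular (linG G) n,
           exists p : KG G, p != 0 &
           forall t : R, 0 <= t <= pi ->
             range f (cis t) -> range f (cis (t / n%:R))];
       c_n_regular G n;
       [/\ lo_n_regular (linG G) n,
           n_divisible (KG G) n &
           exists p : KG G, n.-primitive_root (f p)]].
Proof.
(* A nonzero element of l(G) lifts to a nonzero element of C, positive up to sign. *)
have [c cc c0] : exists2 c : uw G, uw_core c & 0 < c.
  have /existsNP[a /not_implyP[/asboolP[x cx xa] a0]] := hG.
  have : x != 0 by apply/eqP => e; apply: a0; rewrite -xa e.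
  case: (ltgtP x 0) => // h _; last by exists x.
  exists (- x); last by rewrite -oppr0 uw_ltN.
  by apply/(rot_core R); rewrite rotnumN (rot_core R x).2 ?oppr0.
have h12 : n_regular G n /\ (exists p : KG G, p != 0) ->
    [/\ lo_n_regular (linG G) n, exists p : KG G, p != 0 &
        forall t : R, 0 <= t <= pi ->
          range f (cis t) -> range f (cis (t / n%:R))].
  case=> reg K0; split=> //; first exact: n_regular_lin R _ _ hn reg.
  by apply/(range_div hf hn); apply: n_regular_div hn _ cc c0 reg.
have h3 : lo_n_regular (linG G) n ->
    (forall x : uw G, exists y : uw G, rotnum R y * n%:R = rotnum R x) ->
    c_n_regular G n.
  by move=> reg div; apply/(c_n_regular_of_uw hn)/(lo_n_regular_uw hn cc c0 reg div).
have hdiv : [/\ lo_n_regular (linG G) n, exists p : KG G, p != 0 &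
        forall t : R, 0 <= t <= pi ->
          range f (cis t) -> range f (cis (t / n%:R))] ->
    forall x : uw G, exists y : uw G, rotnum R y * n%:R = rotnum R x.
  by case=> _ K0 /(range_div hf hn); apply: rot_div.
tfae.
- exact: h12.
- by move=> h; case: (h) => reg _ _; apply: h3 reg (hdiv h).
(* Assertion (4) is reached through (1) and (2), from which divisibility of Gamma follows. *)
- move=> reg; have K0 := c_n_regular_KG R hn cc c0 reg.
  have h2 := h12 (conj (c_n_regular_n_regular reg) K0).
  have [lreg _ _] := h2.
  by have [? ?] := (KG_div hf hn).2 (hdiv h2).
case=> reg div prim; have /(h3 reg) creg := (KG_div hf hn).1 (conj div prim).
by split; [exact: c_n_regular_n_regular|apply: (c_n_regular_KG R hn cc c0 creg)].
Qed.
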